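(* Let $G$ be a non-amenable residually finite (countable discrete) group. Then for every minimal equicontinuous Cantor system $(Z,G)$ having a free orbit, there exists a Toeplitz $G$-subshift with no invariant probability measures, whose maximal equicontinuous factor is $(Z,G)$.
   Context: A topological dynamical system $(X,G)$ is a non-empty compact metric space $X$ with a continuous action of a countable discrete group $G$; it is minimal if every orbit is dense, equicontinuous if the family of maps $x\mapsto gx$, $g\in G$, is uniformly equicontinuous, and it has a free orbit if some point has trivial stabilizer. It is a Cantor system if $X$ is a Cantor set (non-empty, compact, metric, totally disconnected, without isolated points). A factor map is a continuous surjective equivariant map. Two systems are conjugate if there is a bijective factor map between them. The maximal equicontinuous factor of $(X,G)$ is the factor of $(X,G)$, unique up to conjugacy, that is equicontinuous and such that every factor map from $(X,G)$ to an equicontinuous system factors through it. An invariant probability measure is a $G$-invariant Borel probability measure on the phase space. For a finite alphabet $\Sigma$ (with at least two elements), $G$ acts on $\Sigma^G$ (product topology) by the shift $(hx)(g)=x(h^{-1}g)$; a $G$-subshift is a closed $G$-invariant subset $X\subseteq\Sigma^G$ with the restricted action. An element $x\in\Sigma^G$ is Toeplitz if for every $g\in G$ there is a finite index subgroup $\Gamma$ of $G$ such that $x(g)=x(\gamma^{-1}g)$ for all $\gamma\in\Gamma$. A Toeplitz $G$-subshift is a subshift equal to the orbit closure $\overline{\{gx:g\in G\}}$ of a Toeplitz element $x$. $G$ is residually finite if for every $g\neq 1_G$ some homomorphism from $G$ to a finite group does not send $g$ to the identity. *)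

(* Defs.v *)
From HB Require Import structures.
From mathcomp Require Import all_boot all_order all_algebra all_fingroup.
From mathcomp Require Import all_classical all_reals all_analysis.

Set Implicit Arguments.
Unset Strict Implicit.
Unset Printing Implicit Defensive.

Import Order.TTheory GRing.Theory Num.Theory.

Local Open Scope classical_set_scope.
Local Open Scope ring_scope.

(* Countable discrete groups are [groupType]s with a countable carrier;
   no topology is put on them. *)

(* Existence of a left-invariant finitely additive probability measure defined
   on all subsets of [G]. *)
Definition amenable (R : realType) (G : groupType) : Prop :=
  exists m : set G -> R,
    [/\ forall A, 0 <= m A,
        m [set: G] = 1,
        forall A B, A `&` B = set0 -> m (A `|` B) = m A + m B &
        forall g A, m [set (g * a)%g | a in A] = m A].

Definition residually_finite (G : groupType) : Prop :=
  forall g : G, g <> 1%g ->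
    exists (H : finGroupType) (f : {multiplicative G -> H}), f g <> 1%g.

Definition subgroup (G : groupType) (D : set G) : Prop :=
  [/\ D 1%g,
      forall a b, D a -> D b -> D (a * b)%g &
      forall a, D a -> D (a^-1)%g].

Definition finite_index (G : groupType) (D : set G) : Prop :=
  finite_set [set [set (g * a)%g | a in D] | g in [set: G]].

(* An action is a function [G -> X -> X] satisfying the laws
   below; the group being discrete, it is continuous as soon as every [a g] is. *)

Definition action_laws (G : groupType) (X : Type) (a : G -> X -> X) : Prop :=
  (forall x, a 1%g x = x) /\ (forall g h x, a (g * h)%g x = a g (a h x)).

Definition dynamical_system (R : realType) (G : groupType) (X : metricType R)
    (a : G -> X -> X) : Prop :=
  [/\ [set: X] !=set0, compact [set: X], action_laws a &
      forall g, continuous (a g)].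

Definition minimal_system (G : groupType) (X : topologicalType)
    (a : G -> X -> X) : Prop :=
  forall x, dense (range (a^~ x)).

(* Uniform equicontinuity; the library's [equicontinuous] is the pointwise
   notion. *)
Definition unif_equicontinuous (R : realType) (G : groupType)
    (X : metricType R) (a : G -> X -> X) : Prop :=
  forall e : R, 0 < e -> exists2 d : R, 0 < d &
    forall x y : X, mdist x y < d -> forall g, mdist (a g x) (a g y) < e.

Definition has_free_orbit (G : groupType) (X : Type) (a : G -> X -> X) : Prop :=
  exists x, forall g, a g x = x -> g = 1%g.

Definition cantor_set (R : realType) (X : metricType R) : Prop :=
  [/\ [set: X] !=set0, compact [set: X], totally_disconnected [set: X] &
      isolated [set: X] = set0].

Definition factor_map (G : groupType) (X Y : topologicalType)
    (a : G -> X -> X) (b : G -> Y -> Y) (f : X -> Y) : Prop :=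
  [/\ continuous f, forall y, exists x, f x = y &
      forall g x, f (a g x) = b g (f x)].

(* The source is only a topological space because subshifts carry the product
   topology and no preferred metric. *)
Definition maximal_equicontinuous_factor (R : realType) (G : groupType)
    (X : topologicalType) (a : G -> X -> X)
    (Z : metricType R) (c : G -> Z -> Z) : Prop :=
  [/\ dynamical_system c, unif_equicontinuous c &
      exists2 p : X -> Z, factor_map a c p &
        forall (Y : metricType R) (b : G -> Y -> Y),
          dynamical_system b -> unif_equicontinuous b ->
          forall f : X -> Y, factor_map a b f ->
            exists2 h : Z -> Y, factor_map c b h & f = h \o p].

(* Measurable types are pointed in the library: [borel x0] is the space [X]
   with its Borel sigma-algebra and the irrelevant base point [x0]. *)
Definition pointed_at (X : topologicalType) (x0 : X) : Type := X.
HB.instance Definition _ (X : topologicalType) (x0 : X) :=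
  Topological.copy (pointed_at x0) X.
HB.instance Definition _ (X : topologicalType) (x0 : X) :=
  isPointed.Build (pointed_at x0) x0.

Definition borel (X : topologicalType) (x0 : X) :=
  g_sigma_algebraType (@open (pointed_at x0)).

Definition has_invariant_probability (R : realType) (G : groupType)
    (X : topologicalType) (a : G -> X -> X) : Prop :=
  exists (x0 : X) (P : probability (borel x0) R),
    forall g (A : set (borel x0)), measurable A -> P (a g @^-1` A) = P A.

Notation full_shift G S := {ptws G -> discrete_topology S}.

Definition gshift (G : groupType) (S : finType) (h : G) (x : full_shift G S) :
    full_shift G S :=
  fun g => x (h^-1 * g)%g.

Record subshift (G : groupType) (S : finType) := Subshift {
  subshift_set :> set (full_shift G S);
  subshift_closed : closed subshift_set;
  subshift_invariant : forall h x,
    subshift_set x -> subshift_set (gshift h x) }.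

Definition subshift_act (G : groupType) (S : finType) (X : subshift G S)
    (h : G) (x : set_type X) : set_type X :=
  exist _ (gshift h (\val x))
    (mem_set (subshift_invariant h (set_mem (valP x)))).

Definition toeplitz (G : groupType) (S : finType) (x : full_shift G S) : Prop :=
  forall g, exists D : set G, [/\ subgroup D, finite_index D &
    forall c, D c -> x g = x (c^-1 * g)%g].

Definition toeplitz_subshift (G : groupType) (S : finType) (X : subshift G S) :
    Prop :=
  exists2 x : full_shift G S, toeplitz x &
    subshift_set X = closure (range ((@gshift G S)^~ x)).

(* Main.v *)
(* Non-amenability yields a finite S with |AS| >= 3|A| for all finite A, so by
   Hall's theorem every g in G can be given two labels s, s' in S such that all
   the elements gs, gs' are distinct. Such a labeling can be chosen Toeplitz
   with respect to a chain of finite index subgroups Gam_n of return times to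
   small invariant clopen partitions of Z: a partial labeling is extended by
   labeling finitely many more elements and repeating the result along a sparse
   Gam_n. A strict form of Hall's condition survives: a finite set meeting one
   translate only is controlled by the original extension, and a set joining
   several translates is so large that the expansion absorbs their effect. In
   the orbit closure every configuration sends mass 2 out of each point while
   each point receives mass at most 1, which excludes invariant probabilities.
   One more Toeplitz bit, whose translates separate the cosets of every Gam_n,
   makes Z a factor, and the Toeplitz property makes it the maximal
   equicontinuous one. *)
Require Import Defs.
From HB Require Import structures.
From mathcomp Require Import all_boot all_order all_algebra all_fingroup.
From mathcomp Require Import finmap zify lra.
From mathcomp Require Import all_classical all_reals all_analysis.

Set Implicit Arguments.
Unset Strict Implicit.
Unset Printing Implicit Defensive.

Import Order.TTheory GRing.Theory Num.Theory numFieldNormedType.Exports.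

Local Open Scope classical_set_scope.

(** * Hall's condition *)

Section Hall.
Local Open Scope fset_scope.
Local Open Scope nat_scope.
Variables I U : choiceType.
Implicit Types (nb : I -> {fset U}) (H : pred I) (A B : {fset I}) (d :
  I -> nat).

(** The obstacle is periodicity. Copying one finite extension along a subgroup removes partners near
    every copy at once, and a finite set may meet arbitrarily many copies, so the inequality with
    factor 2 alone cannot be carried through the construction. What is carried is a factor 2 + 1/N,
    with N allowed to grow at each step: its surplus, proportional to the size of the set, pays for
    a loss that is bounded per copy. The payment needs many points of the set around each copy that
    it meets. A set that leaves the surroundings of a copy with fewer points than layers has an
    empty layer there; it splits into two parts with disjoint neighbourhoods, and an induction on
    the size applies. The factor 3 = 2 + 1/1 starts the process with nothing labeled. The free orbit
    makes the intersection of the return groups trivial, which allows the copies to be as far apart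
    as wished. *)

Definition nbhd nb A : {fset U} := \bigcup_(a <- A) nb a.

Lemma nbhdP nb A t :
  reflect (exists2 a, a \in A & t \in nb a) (t \in nbhd nb A).
Proof.
rewrite /nbhd; apply: (iffP (bigfcupP _ _ _ _)) => [[a /andP[aA _] ta]|[a aA
  ta]]; first by exists a.
by exists a => //; rewrite aA.
Qed.

Lemma nbhdU nb A B : nbhd nb (A `|` B) = nbhd nb A `|` nbhd nb B.
Proof.
apply/fsetP => t; rewrite in_fsetU; apply/nbhdP/orP.
  by move=> [a]; rewrite in_fsetU => /orP[aA|aB] ta; [left|right];
    apply/nbhdP; exists a.
by move=> [|] /nbhdP[a aA ta]; exists a; rewrite // in_fsetU aA ?orbT.
Qed.

Lemma nbhdS nb A B : A `<=` B -> nbhd nb A `<=` nbhd nb B.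
Proof.
move=> /fsubsetP AB; apply/fsubsetP => t /nbhdP[a aA ta].
by apply/nbhdP; exists a => //; exact: AB.
Qed.

Lemma nbhdI nb A B : nbhd nb (A `&` B) `<=` nbhd nb A `&` nbhd nb B.
Proof. by rewrite fsubsetI !nbhdS ?fsubsetIl ?fsubsetIr. Qed.

Lemma nbhdD nb A (T : {fset U}) :
  nbhd (fun a => nb a `\` T) A = nbhd nb A `\` T.
Proof.
apply/fsetP => t; rewrite in_fsetD; apply/nbhdP/andP.
  by move=> [a aA]; rewrite in_fsetD => /andP[-> ta]; split=> //; apply/nbhdP;
    exists a.
by move=> [tT /nbhdP[a aA ta]]; exists a => //; rewrite in_fsetD tT.
Qed.

Lemma sum_fsetUI d A B :
  \sum_(a <- A `|` B) d a + \sum_(a <- A `&` B) d a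
  = \sum_(a <- A) d a + \sum_(a <- B) d a.
Proof.
rewrite (big_fsetID _ (mem B)) /= [in RHS](big_fsetID _ (mem B) A) /=.
set X := [fset _ | _ in _ & _]; set Y := [fset _ | _ in _ & _].
set X' := [fset _ | _ in _ & _]; set Y' := [fset _ | _ in _ & _].
have -> : X = B by apply/fsetP => a; rewrite !inE /=; case: (a \in B);
  rewrite ?orbT ?andbF.
have -> : Y = Y' by apply/fsetP => a; rewrite !inE /=; case: (a \in B);
  rewrite ?orbF ?andbF.
have -> : X' = A `&` B by apply/fsetP => a; rewrite !inE.
lia.
Qed.

(* The sets that are tight (attain equality in Hall's condition) are closed
   under union, by submodularity; if every neighbour of [g] were blocked by a
   tight set, the union of these would violate the condition with [g] added. *)
Lemma hall_step nb d g :
  (forall A, \sum_(a <- A) d a <= #|` nbhd nb A|) -> 0 < d g ->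
  exists2 t, t \in nb g &
    forall A, \sum_(a <- A) (d a - (a == g)) <= #|` nbhd nb A `\ t|.
Proof.
move=> hall dg; apply: contrapT => nex.
have blocked t : t \in nb g -> exists A,
    [/\ \sum_(a <- A) d a = #|` nbhd nb A|, g \notin A & t \in nbhd nb A].
  move=> tg; apply: contrapT => nA; apply: nex; exists t => // A.
  rewrite leqNgt; apply/negP => lt; apply: nA; exists A.
  have hA := hall A.
  have le : \sum_(a <- A) (d a - (a == g)) <= \sum_(a <- A) d a.
    by apply: leq_sum => a _; exact: leq_subr.
  have cD := cardfsD1 t (nbhd nb A).
  have tN : t \in nbhd nb A by apply/negPn/negP => tN; move: cD;
    rewrite (negbTE tN) add0n => cD; move: (leq_trans lt (leq_trans le hA));
      rewrite cD ltnn.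
  rewrite tN /= in cD.
  have gA : g \notin A.
    apply/negP => gA; move: lt hA; rewrite !(big_fsetD1 g gA) eqxx /=.
    rewrite [X in _ < _ + X -> _](eq_big_seq d); first by move:
      (\sum_(i <- A `\ g) d i) => x; lia.
    by move=> a; rewrite !inE => /andP[/negPf-> _]; rewrite subn0.
  split=> //; move: lt; rewrite (eq_big_seq d); first by move: hA; move:
    (\sum_(i <- A) d i) => x; lia.
  by move=> a aA; case: eqP aA gA => [-> ->|_ _ _]; rewrite ?subn0.
have tightU A B : \sum_(a <- A) d a = #|` nbhd nb A| ->
    \sum_(a <- B) d a = #|` nbhd nb B| ->
    \sum_(a <- A `|` B) d a = #|` nbhd nb (A `|` B)|.
  move=> tA tB; have := sum_fsetUI d A B; have := hall (A `|` B).
  have := hall (A `&` B); have := fsubset_leq_card (nbhdI nb A B).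
  have := cardfsUI (nbhd nb A) (nbhd nb B); rewrite nbhdU; lia.
have [A [tA gA sub]] : exists A, [/\ \sum_(a <- A) d a = #|` nbhd nb A|,
    g \notin A & nb g `<=` nbhd nb A].
  suff: forall s : seq U, {subset s <= nb g} -> exists A,
      [/\ \sum_(a <- A) d a = #|` nbhd nb A|, g \notin A &
          {subset s <= nbhd nb A}].
    by move=> /(_ (nb g) (fun _ => id)) [A [tA gA sub]]; exists A; split=> //;
      apply/fsubsetP.
  elim=> [_|t s IH sub].
    exists fset0; split=> //.
    by rewrite big_seq_fset0 /nbhd big_seq_fset0 cardfs0.
  have [|A [tA gA sA]] := IH; first by move=> u us; apply: sub;
    rewrite inE us orbT.
  have [B [tB gB sB]] := blocked t (sub _ (mem_head _ _)).
  exists (A `|` B); split; first exact: tightU.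
    by rewrite in_fsetU negb_or gA.
  move=> u; rewrite nbhdU in_fsetU inE => /orP[/eqP->|/sA->//];
    by rewrite sB orbT.
have := hall (g |` A); rewrite big_fsetU1 //= nbhdU.
have -> : nbhd nb [fset g] `|` nbhd nb A = nbhd nb A.
  apply/fsetUidPr/fsubsetP => t /nbhdP[a]; rewrite inE => /eqP->.
  exact: (fsubsetP sub).
lia.
Qed.

Definition hall2 nb H :=
  forall A, {subset A <= H} -> 2 * #|` A| <= #|` nbhd nb A|.

(** The demand is 2 on [H] and 0 elsewhere; two uses of [hall_step] at [g] bring its demand to 0, so
    that [g] leaves [H] together with its two partners. *)
Lemma hall2_step nb H g : hall2 nb H -> H g ->
  exists t : bool -> U, [/\ injective t, forall i, t i \in nb g &
    hall2 (fun a => nb a `\` [fset t true; t false]) [pred a | H a & a != g]].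
Proof.
move=> hall Hg; pose d a := 2 * H a.
have hd A : \sum_(a <- A) d a <= #|` nbhd nb A|.
  pose B := [fset a in A | H a].
  have -> : \sum_(a <- A) d a = 2 * #|` B|.
    rewrite (big_fsetID _ H) /= [X in _ + X]big_seq.
    rewrite (eq_big_seq (fun=> 2)); last by move=> a;
      rewrite !inE /d => /andP[_ ->].
    rewrite [X in _ + X]big1 ?addn0; last by move=> a;
      rewrite !inE /d => /andP[_ /negPf->].
    by rewrite big_const_seq count_predT iter_addn_0.
  apply: leq_trans (hall B _) _; first by move=> a; rewrite !inE => /andP[].
  by apply/fsubset_leq_card/nbhdS/fsubsetP => a; rewrite !inE => /andP[].
have [|t1 t1g h1] := hall_step (g := g) hd; first by rewrite /d Hg.
have h1' A : \sum_(a <- A) (d a - (a == g)) <= #|` nbhd (fun a => nb a `\ t1)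
  A|.
  by rewrite nbhdD.
have [|t2 t2g h2] := hall_step (g := g) h1'; first by rewrite /d eqxx Hg.
move: t2g; rewrite !inE => /andP[t21 t2g].
exists (fun i => if i then t1 else t2); split.
- by move=> [] [] //= E; move: t21; rewrite E eqxx.
- by case.
- move=> A AH; have := h2 A; rewrite nbhdD nbhdD fsetDDl.
  rewrite (eq_big_seq (fun=> 2)).
    by rewrite big_const_seq count_predT iter_addn_0.
  by move=> a /AH; rewrite !inE /d => /andP[-> /negPf->].
Qed.

Definition served (f : I -> bool -> U) (s : seq I) : {fset U} :=
  [fset f b i | b in s, i in [:: true; false]].

Lemma servedP f s t :
  reflect (exists2 b, b \in s & exists i, t = f b i) (t \in served f s).
Proof.
apply: (iffP (imfset2P _ _ _ _ _)) => -[b bs].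
  by move=> [i _ ->]; exists b => //; exists i.
by move=> [i ->]; exists b => //; exists i => //; case: i.
Qed.

Definition injective_on (s : seq I) (f : I -> bool -> U) :=
  forall a b i j, a \in s -> b \in s -> f a i = f b j -> a = b /\ i = j.

Lemma card_served f s : uniq s -> injective_on s f ->
  #|` served f s| = 2 * size s.
Proof.
elim: s => [_ _|a s IH /= /andP[as_ us] inj].
  by rewrite muln0; apply/eqP; rewrite cardfs_eq0; apply/eqP/fsetP => t;
    rewrite inE; apply/servedP => -[].
have -> : served f (a :: s) = [fset f a true; f a false] `|` served f s.
  apply/fsetP => t; rewrite in_fsetU in_fset2; apply/servedP/orP.
    move=> [b]; rewrite in_cons => /orP[/eqP-> [[] ->]|bs [i ->]].
    - by left; rewrite eqxx.
    - by left; rewrite eqxx orbT.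
    - by right; apply/servedP; exists b; [|exists i].
  move=> [/orP[]/eqP ->|/servedP[b bs [i ->]]].
  - by exists a; [exact: mem_head | exists true].
  - by exists a; [exact: mem_head | exists false].
  - by exists b; [rewrite in_cons bs orbT | exists i].
rewrite cardfsU disjoint_fsetI0 ?cardfs0 ?subn0; last first.
  apply/fdisjointP => t; rewrite in_fset2 => ta; apply/servedP => -[b bs [i E]].
  suff: a = b by move=> ab; move: as_; rewrite ab bs.
  have bs' : b \in a :: s by rewrite in_cons bs orbT.
  by case/orP: ta => /eqP ta; rewrite ta in E;
    have [] := inj _ _ _ _ (mem_head _ _) bs' E.
rewrite IH //; last first.
  by move=> b c i j bs cs; apply: inj; rewrite in_cons ?bs ?cs orbT.
rewrite cardfs2; case: eqP => [/inj|_ /=]; last lia.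
by rewrite mem_head => /(_ isT isT)[].
Qed.

Lemma extend_assignment nb g s (t : bool -> U) f :
  injective t -> (forall i, t i \in nb g) ->
  (forall a i, a \in s -> f a i \in nb a `\` [fset t true; t false]) ->
  injective_on s f -> g \notin s ->
  exists f', [/\ forall a i, a \in g :: s -> f' a i \in nb a,
    injective_on (g :: s) f' &
    served f' (g :: s) = [fset t true; t false] `|` served f s].
Proof.
move=> tinj tg fn finj gs.
exists (fun a => if a == g then t else f a); split.
- move=> a i; rewrite inE; case: eqP => [-> _|_ /= as_]; first exact: tg.
  by have := fn a i as_; rewrite inE => /andP[].
- have tf a i j : a \in s -> t i = f a j -> False.
    move=> as_ E; have := fn a j as_; rewrite -E !inE.
    by case: i E; rewrite eqxx ?orbT.
  move=> a b i j; rewrite !inE.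
  case: (eqVneq a g) => [->|_] /= as_; case: (eqVneq b g) => [->|_] /= bs.
  + by move=> /tinj.
  + by move=> /(tf _ _ _ bs).
  + by move=> /esym/(tf _ _ _ as_).
  + exact: finj.
- have sg b : b \in s -> (b == g) = false.
    by move=> bs; apply/negP => /eqP E; move: gs; rewrite -E bs.
  apply/fsetP => u; rewrite in_fsetU in_fset2; apply/servedP/orP.
    move=> [b]; rewrite in_cons => /orP[/eqP->|bs] [i ->].
      by left; rewrite eqxx; case: i; rewrite eqxx ?orbT.
    by right; rewrite sg //; apply/servedP; exists b; [exact: bs | exists i].
  move=> [/orP[]/eqP ->|/servedP[b bs [i ->]]].
  + by exists g; [exact: mem_head | exists true; rewrite eqxx].
  + by exists g; [exact: mem_head | exists false; rewrite eqxx].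
  + by exists b; [rewrite in_cons bs orbT | exists i; rewrite sg].
Qed.

Lemma hall2_seq nb H (s : seq I) : inhabited U ->
    hall2 nb H -> uniq s -> {subset s <= H} ->
  exists f : I -> bool -> U,
    [/\ forall a i, a \in s -> f a i \in nb a, injective_on s f &
        hall2 (fun a => nb a `\` served f s) [pred a | H a & a \notin s]].
Proof.
move=> [u0]; elim: s nb H => [|g s IH] nb H hall /=.
  move=> _ _; exists (fun _ _ => u0); split=> // A AH.
  have -> : (fun a => nb a `\` served (fun _ _ => u0) [::]) = nb.
    apply/funext => a; rewrite -[RHS]fsetD0; congr (_ `\` _); apply/fsetP => t.
    by rewrite inE; apply/servedP => -[b].
  by apply: hall => a /AH; rewrite inE /= andbT.
move=> /andP[gs us] sH.
have Hg : H g by apply: sH; rewrite mem_head.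
have [t [tinj tg h1]] := hall2_step hall Hg.
have [|f [fn finj h2]] := IH _ _ h1 us.
  move=> a as_; rewrite inE; apply/andP; split; last by apply:
    contraNneq gs => <-.
  by apply: sH; rewrite inE as_ orbT.
have [f' [f'n f'inj E]] := extend_assignment tinj tg fn finj gs.
exists f'; split=> // A AH; rewrite E nbhdD -fsetDDl -nbhdD -nbhdD; apply: h2.
by move=> a /AH; rewrite !inE negb_or -andbA.
Qed.

(** Growth by the factor 2 + 1/N, written without division; the condition weakens as [N] grows. *)
Definition expanding nb H N :=
  forall A, {subset A <= H} -> (2 * N + 1) * #|` A| <= N * #|` nbhd nb A|.

Lemma expanding_ratio_le N M a c :
  N <= M -> (2 * N + 1) * a <= N * c -> (2 * M + 1) * a <= M * c.
Proof. nia. Qed.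

(* After serving [g], Hall's condition may have become tight; the tight sets
   have bounded size, so serving the largest one as well leaves positive slack,
   which together with the linear slack of large sets is again an expansion. *)
Lemma expanding_serve nb H N g : inhabited U -> expanding nb H N -> H g ->
  exists (F : {fset I}) (f : I -> bool -> U) (M : nat),
    [/\ g \in F, {subset F <= H}, forall a i, a \in F -> f a i \in nb a,
        injective_on F f &
        expanding (fun a => nb a `\` served f F)
          [pred a | H a & a \notin F] M].
Proof.
move=> U0 exp Hg.
have hall : hall2 nb H by move=> A /exp; nia.
have [t [tinj tg h1]] := hall2_step hall Hg.
set T := [fset t true; t false] in h1; set nb1 := (fun a => _) in h1.
set H1 := [pred a | _ & _] in h1.
pose tight A := {subset A <= H1} /\ #|` nbhd nb1 A| = 2 * #|` A|.
have cardT (X : {fset U}) : #|` X| <= #|` X `\` T| + 2.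
  rewrite -(cardfsID T) addnC leq_add2l.
  apply: leq_trans (fsubset_leq_card (fsubsetIr _ _)) _.
  by rewrite cardfs2; case: (_ != _).
(* A tight [A] has at most 2|A| + 2 neighbours in [nb], against at least (2 + 1/N)|A|. *)
have tight_le A : tight A -> #|` A| <= 2 * N.
  move=> [AH E]; have := exp A; rewrite /nb1 nbhdD in E.
  have := cardT (nbhd nb A); rewrite E => le /(_ _).
  have sAH : {subset A <= H} by move=> a /AH; rewrite inE => /andP[].
  by move=> /(_ sAH); nia.
have [B [tB Bmax]] : exists B, tight B /\ forall A, tight A -> #|` A| <= #|` B|.
  pose P n := `[< exists2 A, tight A & #|` A| = n >].
  have exP : exists n, P n.
    exists 0; apply/asboolP; exists fset0; last by rewrite cardfs0.
    by split=> //; rewrite /nbhd big_seq_fset0 cardfs0.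
  have ubP n : P n -> n <= 2 * N by move=> /asboolP[A /tight_le + <-].
  case: (ex_maxnP exP ubP) => n /asboolP[B tB nB] nmax; exists B;
    split=> // A tA.
  by rewrite nB; apply: nmax; apply/asboolP; exists A.
have [BH1 tightB] := tB.
have gB : g \notin B by apply/negP => /BH1; rewrite inE eqxx andbF.
have [f [fn finj _]] := hall2_seq U0 h1 (fset_uniq B) BH1.
(* Both sides have 2|B| elements, so serving [B] uses up its whole neighbourhood. *)
have sT1 : served f B = nbhd nb1 B.
  apply/eqP; rewrite eqEfcard (card_served (fset_uniq B) finj) tightB leqnn
    andbT.
  apply/fsubsetP => u /servedP[b bB [i ->]]; apply/nbhdP; exists b => //;
    exact: fn.
have [f' [f'n f'inj E]] := extend_assignment tinj tg fn finj gB.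
have memF a : (a \in g |` B) = (a \in g :: (B : seq I)) by rewrite !inE.
have EF : served f' (g |` B) = T `|` nbhd nb1 B.
  rewrite -sT1 -E; apply/fsetP => u; apply/servedP/servedP => -[b bF iu];
  by exists b => //; rewrite ?memF // -memF.
pose M := 4 * N * #|` g |` B| + 2 * N.
exists (g |` B), f', M; split.
- by rewrite !inE eqxx.
- by move=> a; rewrite !inE => /orP[/eqP->//|/BH1]; rewrite inE => /andP[].
- by move=> a i; rewrite memF; exact: f'n.
- by move=> a b i j; rewrite !memF; exact: f'inj.
move=> A AH; rewrite nbhdD EF.
have [->|[a0 a0A]] := fset_0Vmem A; first by rewrite cardfs0 muln0.
have sAH : {subset A <= H} by move=> a /AH; rewrite inE => /andP[].
have sAH1 : {subset A <= H1}.
  by move=> a /AH; rewrite !inE negb_or => /and3P[-> ->].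
have dAB : A `&` B = fset0.
  apply/eqP; rewrite -fsubset0; apply/fsubsetP => a; rewrite in_fsetI.
  by move=> /andP[/AH]; rewrite !inE negb_or => /and3P[_ _ /negPf->].
have cAB : #|` A `|` B| = #|` A| + #|` B| by rewrite cardfsU dAB cardfs0 subn0.
have cA : 0 < #|` A| by rewrite cardfs_gt0; apply/fset0Pn; exists a0.
have sABH : {subset A `|` B <= H1}.
  by move=> a; rewrite in_fsetU => /orP[/sAH1|/BH1].
have E1 : #|` nbhd nb1 (A `|` B)|
    = #|` nbhd nb A `\` (T `|` nbhd nb1 B)| + 2 * #|` B|.
  rewrite -tightB nbhdU -fsetDDl -nbhdD -/nb1 fsetUC cardfsU cardfsD.
  have := fsubset_leq_card (fsubsetIl (nbhd nb1 A) (nbhd nb1 B)).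
  rewrite fsetIC; lia.
(* Equality would make the union of [A] and [B] tight, and larger than [B]. *)
have slack : 2 * #|` A| < #|` nbhd nb A `\` (T `|` nbhd nb1 B)|.
  have := h1 _ sABH; rewrite leq_eqVlt => /orP[/eqP E2|];
    last by rewrite E1 cAB; lia.
  have /Bmax : tight (A `|` B) by split.
  by rewrite cAB; lia.
have cF : #|` g |` B| = 1 + #|` B| by rewrite cardfsU1 gB.
have le : #|` nbhd nb A|
    <= #|` nbhd nb A `\` (T `|` nbhd nb1 B)| + 2 * #|` g |` B|.
  rewrite -(cardfsID (T `|` nbhd nb1 B)) addnC leq_add2l.
  apply: leq_trans (fsubset_leq_card (fsubsetIr _ _)) _.
  apply: leq_trans (leq_card_fsetU _ _) _; rewrite tightB cF.
  have : #|` T| <= 2 by rewrite cardfs2; case: (_ != _).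
  lia.
have := exp A sAH.
move: le slack; rewrite /M.
move: (#|` nbhd nb A|) (#|` nbhd nb A `\` _|) (#|` A|) (#|` g |` B|) => n c a
  f0.
move=> le slack ex; have [af|af] := leqP a (4 * N * f0); nia.
Qed.
End Hall.

(** * Partial labelings *)

Section Labelings.
Local Open Scope fset_scope.
Local Open Scope nat_scope.
Variables (G : groupType) (S : {fset G}) (s0 : S).
Notation labeling := (G -> option {ffun bool -> S}).
Implicit Types (p q : labeling) (A B F : {fset G}) (D : set G).

Definition mulfs A B : {fset G} := [fset (a * b)%g | a in A, b in B].

Lemma mulfsP A B t :
  reflect (exists2 a, a \in A & exists2 b, b \in B & t = (a * b)%g)
          (t \in mulfs A B).
Proof.
apply: (iffP (imfset2P _ _ _ _ _)) => -[a aA [b bB ->]];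
by exists a => //; exists b.
Qed.

(** A label is a displacement in [S], so that shifting a labeling shifts its targets. The value 1 at
    an unlabeled [g] is a dummy: [valid] and [used] look at labeled elements only. *)
Definition target p g i : G :=
  if p g is Some l then (g * val (l i))%g else 1%g.

Definition valid p := forall g h i j,
  p g -> p h -> target p g i = target p h j -> g = h /\ i = j.

Definition used p t := exists g i, p g /\ t = target p g i.

Definition free_nbr p g : {fset G} :=
  [fset t in mulfs [fset g] S | ~~ `[< used p t >]].

Lemma free_nbrP p g t :
  reflect ((exists2 s, s \in S & t = (g * s)%g) /\ ~ used p t)
          (t \in free_nbr p g).
Proof.
rewrite /free_nbr !inE /= andbC; apply: (iffP andP).
  move=> [/asboolP nu /mulfsP[_ /fset1P-> st]]; split=> //.
move=> [[s sS ->] nu]; split; first exact/asboolP.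
by apply/mulfsP; exists g; [rewrite inE | exists s].
Qed.

Definition hole p : pred G := fun g => ~~ p g.

Definition good p N := expanding (free_nbr p) (hole p) N.

Definition periodic D p := forall c g, D c -> p (c * g)%g = p g.

Definition extends p q := forall g, p g -> q g = p g.

Lemma target_ext p q g i : q g = p g -> target q g i = target p g i.
Proof. by rewrite /target => ->. Qed.

Lemma target_shift p q c g i : p g -> q (c * g)%g = p g ->
  target q (c * g)%g i = (c * target p g i)%g.
Proof. by rewrite /target => + ->; case: (p g) => // l _; rewrite mulgA. Qed.

Lemma target_nbr p g i : p g -> exists2 s, s \in S & target p g i = (g * s)%g.
Proof. by rewrite /target; case: (p g) => // l _; exists (val (l i)) => //;
  exact: valP. Qed.

Lemma used_ext p q t : extends p q -> used p t -> used q t.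
Proof.
move=> pq [g [i [pg ->]]]; exists g, i; split; first by rewrite pq.
by rewrite (target_ext _ (pq g pg)).
Qed.

Lemma used_shift p D c t : periodic D p -> D c -> used p t -> used p (c * t)%g.
Proof.
move=> per Dc [g [i [pg ->]]]; exists (c * g)%g, i; split; first by rewrite per.
by rewrite (@target_shift p) // per.
Qed.

Lemma local_fill p N g : valid p -> good p N -> hole p g ->
  exists F q M,
    [/\ g \in F, {subset F <= hole p},
        (forall a, a \notin F -> q a = p a), (forall a, a \in F -> q a) &
        valid q /\ good q M].
Proof.
move=> vp gp pg.
have [F [f [M [gF FH fn finj exp]]]] := expanding_serve (inhabits 1%g) gp pg.
(* The default [s0] is never taken on [F]: [f a i] lies in the translate of [S] by [a]. *)
pose q a := if a \in F then
  Some [ffun i : bool => insubd s0 (a^-1 * f a i)%g] else p a.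
have qF a : a \in F -> q a by rewrite /q => ->.
have qnF a : a \notin F -> q a = p a by rewrite /q => /negPf->.
have tF a i : a \in F -> target q a i = f a i.
  move=> aF; rewrite /target /q aF ffunE.
  have /free_nbrP[[s sS E] _] := fn a i aF.
  by rewrite E mulKg insubdK // mulgA.
have pnF a : p a -> a \notin F.
  by move=> pa; apply/negP => /FH; rewrite unfold_in /hole pa.
have fu a i h j : a \in F -> p h -> f a i = target p h j -> False.
  move=> aF ph E; have /free_nbrP[_] := fn a i aF.
  by apply; exists h, j.
exists F, q, M; split=> //; split.
  move=> a b i j.
  have [aF _|aF] := boolP (a \in F); have [bF|bF] := boolP (b \in F).
  - by move=> _; rewrite !tF //; exact: finj.
  - by rewrite qnF // => pb; rewrite tF // (target_ext _ (qnF _ bF)) => /(fu _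
      _ _ _ aF pb).
  - by rewrite qnF // => pa _; rewrite (tF b) // (target_ext _ (qnF _ aF)) =>
      /esym/(fu _ _ _ _ bF pa).
  - by rewrite !qnF // => pa pb;
      rewrite (target_ext _ (qnF _ aF)) (target_ext _ (qnF _ bF)); exact: vp.
have usedq t : used q t <-> used p t \/ t \in served f F.
  split.
    move=> [a [i [qa ->]]]; have [aF|aF] := boolP (a \in F).
      by right; rewrite tF //; apply/servedP; exists a => //; exists i.
    by left; exists a, i; rewrite -(qnF _ aF) (target_ext _ (qnF _ aF)).
  move=> [[a [i [pa ->]]]|/servedP[a aF [i ->]]].
    by exists a, i; rewrite qnF ?pnF // (target_ext _ (qnF _ (pnF _ pa))).
  by exists a, i; rewrite tF // qF.
have En : free_nbr q = fun a => free_nbr p a `\` served f F.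
  apply/funext => a; apply/fsetP => t; rewrite in_fsetD.
  apply/free_nbrP/andP.
    move=> [st nu]; split; first by apply/negP => h; apply: nu; apply/usedq;
      right.
    by apply/free_nbrP; split=> // h; apply: nu; apply/usedq; left.
  by move=> [/negP nt /free_nbrP[st nu]]; split=> // /usedq[].
rewrite /good En => A AH; apply: exp => a aA.
have : hole q a by exact: AH.
rewrite inE /hole; have [aF|aF] := boolP (a \in F); first by rewrite qF.
by rewrite qnF // andbT.
Qed.

End Labelings.

(** * Repeating a finite extension along a sparse subgroup *)

Section PeriodicFill.
Local Open Scope fset_scope.
Local Open Scope nat_scope.
Variables (G : groupType) (S : {fset G}) (s0 : S).
Notation labeling := (G -> option {ffun bool -> S}).
Variables (p q : labeling) (D : set G) (F : {fset G}) (N M : nat).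
Hypotheses (p_periodic : periodic D p) (p_valid : valid p) (p_good : good p N).
Hypotheses (F_hole : {subset F <= hole p})
  (q_out : forall a, a \notin F -> q a = p a) (q_in : forall a, a \in F -> q a)
  (q_valid : valid q) (q_good : good q M).

(** If [a * s = b * t] then [b = a * s * t^-1]: elements with a common neighbour differ by a factor
    in [V]. Hence [layer 0] catches everything that competes with [F] for a target, and [layer i]
    has no neighbour in common with the complement of [layer i.+1]. *)
Let V : {fset G} := [fset (s * t^-1)%g | s in S, t in S].
Let layer i := iter i.+1 (fun B => mulfs B V) F.
(** One copy of [F] takes at most 2|F| targets; shared among [R] elements this is a loss of 1/(2N)
    per element, half of the surplus 1/N. *)
Let R := 4 * N * #|` F|.

Definition spread_radius : {fset G} :=
  [fset (a * b^-1)%g | a in layer R, b in layer R].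

Variable D' : set G.
Hypotheses (D'_subgroup : subgroup D') (D'D : forall c, D' c -> D c)
  (D'_sep : forall c, D' c -> c \in spread_radius -> c = 1%g).

(** The values of [q] on [F] are copied to each [c^-1 * F] with [c] in [D']. By [D'_sep] at most one
    [c] applies, so the choice made by [cid] is immaterial. *)
Definition spread : labeling := fun h =>
  match pselect (exists c, D' c /\ (c * h)%g \in F) with
  | left e => q (projT1 (cid e) * h)%g
  | right _ => p h
  end.

Let D'1 : D' 1%g. Proof. by case: D'_subgroup. Qed.
Let D'M a b : D' a -> D' b -> D' (a * b)%g. Proof. by case:
  D'_subgroup => _ h _; exact: h. Qed.
Let D'V a : D' a -> D' (a^-1)%g. Proof. by case: D'_subgroup => _ _; exact. Qed.

Let VP s t : s \in S -> t \in S -> (s * t^-1)%g \in V.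
Proof. by move=> sS tS; apply/imfset2P; exists s => //; exists t. Qed.

Let layer0 a s t : a \in F -> s \in S -> t \in S -> (a * s * t^-1)%g \in layer
  0.
Proof.
move=> aF sS tS; apply/mulfsP; exists a => //; exists (s * t^-1)%g;
  first exact: VP.
by rewrite mulgA.
Qed.

Let layerS i a s t : a \in layer i -> s \in S -> t \in S ->
  (a * s * t^-1)%g \in layer i.+1.
Proof.
move=> aF sS tS; apply/mulfsP; exists a => //; exists (s * t^-1)%g;
  first exact: VP.
by rewrite mulgA.
Qed.

Let layer_le i j : i <= j -> {subset layer i <= layer j}.
Proof.
elim: j => [|j IH]; first by rewrite leqn0 => /eqP->.
rewrite leq_eqVlt => /orP[/eqP->//|/IH sub] a /sub aj.
by rewrite -(mulgK (val s0) a); apply: layerS aj _ _; exact: valP.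
Qed.

Let F_layer i : {subset F <= layer i}.
Proof.
move=> a aF; apply: (layer_le (leq0n i)); rewrite -(mulgK (val s0) a).
by apply: layer0 aF _ _; exact: valP.
Qed.

Let sep c d h : D' c -> D' d -> (c * h)%g \in layer R -> (d * h)%g \in layer R
  ->
  c = d.
Proof.
move=> Dc Dd ch dh; apply/eqP; rewrite -divg_eq1; apply/eqP/D'_sep.
  exact/D'M/D'V.
apply/imfset2P; exists (c * h)%g => //; exists (d * h)%g => //.
by rewrite invgM mulgA mulgK.
Qed.

Lemma spread_in c h : D' c -> (c * h)%g \in F -> spread h = q (c * h)%g.
Proof.
move=> Dc ch; rewrite /spread; case: pselect => [e|]; last by case; exists c.
by case: cid => d [Dd dh] /=; rewrite (sep Dc Dd (F_layer _ ch) (F_layer _ dh)).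
Qed.

Lemma spread_out h : (forall c, D' c -> (c * h)%g \notin F) -> spread h = p h.
Proof.
move=> out; rewrite /spread; case: pselect => // e; exfalso.
by case: e => c [Dc ch]; have := out c Dc; rewrite ch.
Qed.

Let spreadP h : (exists2 c, D' c & (c * h)%g \in F) \/
  (forall c, D' c -> (c * h)%g \notin F).
Proof.
have [[c [Dc ch]]|n] := pselect (exists c, D' c /\ (c * h)%g \in F).
  by left; exists c.
by right=> c Dc; apply/negP => ch; apply: n; exists c.
Qed.

Lemma spread_periodic : periodic D' spread.
Proof.
move=> c h Dc; have [[d Dd dh]|out] := spreadP h.
  rewrite (spread_in Dd dh) (@spread_in (d * c^-1)%g);
    rewrite ?mulgA ?mulgVK //.
  exact/D'M/D'V.
rewrite (spread_out out) spread_out ?p_periodic //; first exact: D'D.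
by move=> d Dd; rewrite mulgA; apply/out/D'M.
Qed.

Let pF h : p h -> h \notin F.
Proof. by move=> ph; apply/negP => /F_hole; rewrite unfold_in /hole ph. Qed.

Lemma q_extends : extends p q.
Proof. by move=> h /pF; exact: q_out. Qed.

Lemma spread_extends : extends p spread.
Proof.
move=> h ph; have [[c Dc ch]|/spread_out//] := spreadP h.
by have := pF (_ : p (c * h)%g); rewrite p_periodic ?ch; [move=> /(_ ph)|exact:
  D'D].
Qed.

Lemma spread_base h : h \in F -> spread h = q h.
Proof. by move=> hF; rewrite -{2}(mul1g h) (@spread_in 1%g) ?mul1g. Qed.

Let spread_shift c h : D' c ->
  (forall d, D' d -> d <> c -> (d * h)%g \notin F) -> spread h = q (c * h)%g.
Proof.
move=> Dc other; have [ch|ch] := boolP ((c * h)%g \in F); first exact: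
  spread_in.
rewrite spread_out ?q_out ?p_periodic //; first exact: D'D.
by move=> d Dd; have [->|/eqP dc] := eqVneq d c; [|exact: other].
Qed.

Let target_spread c h i : D' c -> (c * h)%g \in F ->
  target spread h i = (c^-1 * target q (c * h)%g i)%g.
Proof.
move=> Dc ch; have E := spread_in Dc ch.
by rewrite (@target_shift _ _ spread) ?mulKg ?E ?q_in.
Qed.

(** If [g] lies in the copy of [F] given by [c] and shares a target with [h], then [c * h] is in
    [layer 0], so no other copy contains [h]; on both elements [spread] is then the translate of
    [q], which is valid. Outside all copies it is [p]. *)
Lemma spread_valid : valid spread.
Proof.
move=> g h i j.
wlog: g h i j / (exists2 c, D' c & (c * g)%g \in F) \/
    (forall c, D' c -> (c * h)%g \notin F).
  move=> wl sg sh E; have [in_h|out_h] := spreadP h; last by apply: wl => //;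
    right.
  by have [] := wl h g j i _ sh sg (esym E); first by left.
move=> gh sg sh E.
have [[c Dc cg]|out_g] := spreadP g; last first.
  case: gh => [[c Dc cg]|out_h]; first by have := out_g c Dc; rewrite cg.
  move: sg sh; rewrite (spread_out out_g) (spread_out out_h) => pg ph.
  move: E; rewrite (target_ext _ (spread_out out_g)) (target_ext _ (spread_out
    out_h)).
  exact: p_valid.
have eh : spread h = q (c * h)%g.
  apply: spread_shift => // d Dd dc; apply/negP => dh; apply: dc.
  have [s sS gs] := target_nbr i sg; have [t tS ht] := target_nbr j sh.
  apply: (@sep _ _ h) => //; first exact: F_layer.
  have -> : (c * h = c * g * s * t^-1)%g.
    by rewrite -!mulgA; congr (_ * _)%g; rewrite mulgA -gs E ht mulgK.
  by apply: layer_le (leq0n R) _ _; exact: layer0.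
have eg := spread_in Dc cg.
have [|||/mulgI->//] := @q_valid (c * g)%g (c * h)%g i j.
- by rewrite q_in.
- by rewrite -eh.
by rewrite (@target_shift _ _ spread _ _ g) // (@target_shift _ _ spread _ _ h)
  // E.
Qed.

Let used_spread t : used spread t -> used p t \/
  exists2 c, D' c & exists a i, a \in F /\ (c * t)%g = target q a i.
Proof.
move=> [g [i [sg ->]]]; have [[c Dc cg]|out] := spreadP g.
  by right; exists c => //; exists (c * g)%g, i;
    rewrite (target_spread _ Dc cg) mulKVg.
by left; exists g, i; rewrite -(spread_out out) (target_ext _ (spread_out out)).
Qed.

Let newly_used (a s c b : G) i : s \in S -> b \in F ->
  (c * (a * s))%g = target q b i -> (c * a)%g \in layer 0.
Proof.
move=> sS bF E; have [t tS Et] := target_nbr i (q_in bF).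
have -> : (c * a = b * t * s^-1)%g by rewrite -Et -E mulgA mulgK.
exact: layer0.
Qed.

(** Other copies are too far away to take neighbours of [A]. Hence [c] moves [A] into the holes of
    [q], and every neighbour free for [q] comes from one free for [spread]. *)
Let one_cell (A : {fset G}) c : D' c -> {subset A <= hole spread} ->
  (forall a, a \in A -> (c * a)%g \in layer R) ->
  (2 * M + 1) * #|` A| <= M * #|` nbhd (free_nbr spread) A|.
Proof.
move=> Dc Ahole Acell.
pose cA := [fset (c * a)%g | a in A].
have <- : #|` cA| = #|` A| by rewrite card_imfset //; exact: mulgI.
have cAhole : {subset cA <= hole q}.
  move=> _ /imfsetP[a /= aA ->]; have /negP na : hole spread a := Ahole _ aA.
  apply/negP => qa; apply: na; have [aF|aF] := boolP ((c * a)%g \in F).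
    by rewrite (spread_in Dc aF).
  have pa : p a by move: qa; rewrite q_out // p_periodic //; exact: D'D.
  by rewrite spread_extends.
apply: leq_trans (q_good cAhole) _; rewrite leq_mul2l; apply/orP; right.
apply: (@leq_trans #|` [fset (c * t)%g | t in nbhd (free_nbr spread) A]|);
  last first.
  exact: leq_imfset_card.
apply: fsubset_leq_card; apply/fsubsetP => u /nbhdP[_ /imfsetP[a /= aA ->]].
move=> /free_nbrP[[s sS ->] nu]; apply/imfsetP; exists (a * s)%g;
  rewrite ?mulgA //=.
apply/nbhdP; exists a => //; apply/free_nbrP; split; first by exists s.
move=> /used_spread[ut|[d Dd [b [i [bF E]]]]]; apply: nu.
  rewrite -mulgA; apply: (used_ext q_extends); apply:
    used_shift p_periodic _ ut.
  exact: D'D.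
have dc : d = c.
  by apply: (@sep _ _ a) => //; [exact: layer_le (newly_used sS bF E) | exact:
    Acell].
by exists b, i; split; [exact: q_in | rewrite -E dc mulgA].
Qed.

Let cell (c : G) (A : {fset G}) i := [fset a in A | (c * a)%g \in layer i].

(** [C] collects the copies that compete with [A], and [Z] contains the targets that they take. The
    translates of [layer R] are disjoint and hold at least [R] elements of [A] each, so R|C| is at
    most |A|, whereas |Z| is at most 2|F||C|; by the choice of [R], 2N|Z| is at most |A|. *)
Let many_cells (A : {fset G}) :
  (forall c a, D' c -> a \in A -> (c * a)%g \in layer 0 -> R <= #|` cell c A
    R|) ->
  {subset A <= hole spread} ->
  (2 * (2 * N) + 1) * #|` A| <= 2 * N * #|` nbhd (free_nbr spread) A|.
Proof.
move=> big Ahole.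
pose kappa a := xget 1%g [set c | D' c /\ (c * a)%g \in layer 0]%classic.
pose C := [fset kappa a | a in
  [fset a in A | `[< exists c, D' c /\ (c * a)%g \in layer 0 >]]].
have CP c a : a \in A -> D' c -> (c * a)%g \in layer 0 -> c \in C.
  move=> aA Dc ca; apply/imfsetP; exists a.
    by rewrite !inE aA; apply/asboolP; exists c.
  rewrite /kappa; case: xgetP => [d _ [Dd da]|/(_ c)]; last by case.
  by apply: (@sep _ _ a) => //; apply: layer_le (leq0n R) _ _.
have CD c : c \in C -> D' c /\ exists2 a, a \in A & (c * a)%g \in layer 0.
  move=> /imfsetP[a]; rewrite !inE => /andP[aA /asboolP[d [Dd da]]] ->.
  rewrite /kappa; case: xgetP => [e _ [De ea]|/(_ d)]; last by case.
  by split=> //; exists a.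
have le1 : R * #|` C| <= #|` A|.
  have sub : \bigcup_(c <- C) cell c A R `<=` A.
    by apply/fsubsetP => a /bigfcupP[c _]; rewrite !inE => /andP[].
  apply: leq_trans (fsubset_leq_card sub).
  rewrite (card_fset_sum1 (\bigcup_(c <- C) _)) partition_disjoint_bigfcup;
    last first.
    move=> c d /CD[Dc _] /CD[Dd _] cd; apply/fdisjointP => a.
    rewrite !inE => /andP[aA ca]; rewrite aA /=; apply: contra_neqN cd => da.
    exact: (@sep _ _ a).
  rewrite mulnC card_fset_sum1 big_distrl /= big_seq [X in _ <= X]big_seq.
  apply: leq_sum => c /CD[Dc [a aA ca]]; rewrite mul1n -card_fset_sum1.
  exact: big ca.
pose Z := [fset (c^-1 * u)%g | c in C, u in served (target q) F].
have le2 : #|` nbhd (free_nbr p) A| <= #|` nbhd (free_nbr spread) A| + #|` Z|.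
  apply: leq_trans (leq_card_fsetU _ _); apply: fsubset_leq_card.
  apply/fsubsetP => t /nbhdP[a aA /free_nbrP[[s sS ->] nu]]; rewrite in_fsetU.
  have [us|nus] := pselect (used spread (a * s)%g); last first.
    apply/orP; left; apply/nbhdP; exists a => //; apply/free_nbrP; split=> //.
    by exists s.
  apply/orP; right; have [//|[c Dc [b [i [bF E]]]]] := used_spread us.
  apply/imfset2P; exists c; first exact: CP aA Dc (newly_used sS bF E).
  exists (c * (a * s))%g; last by rewrite mulKg.
  by rewrite E; apply/servedP; exists b => //; exists i.
have le3 : #|` Z| <= 2 * #|` F| * #|` C|.
  have <- : #|` served (target q) F| = 2 * #|` F|.
    apply: card_served => // a b i j aF bF; apply: q_valid; exact: q_in.
  apply: (@leq_trans #|` [fset z in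
      [seq (c^-1 * u)%g | c <- C, u <- served (target q) F]]|).
    apply: fsubset_leq_card; apply/fsubsetP => z /imfset2P[c cC [u uT ->]].
    by rewrite !inE /=; apply: allpairs_f.
  by rewrite card_fseq mulnC; apply: leq_trans (size_undup _) _;
    rewrite size_allpairs.
have holeA : {subset A <= hole p}.
  move=> a /Ahole; rewrite !unfold_in /hole; apply: contra => pa.
  by rewrite spread_extends.
have := p_good holeA; move: le1 le2 le3; rewrite /R.
move: (#|` A|) (#|` F|) (#|` C|) (#|` Z|) => a f c z.
move: (#|` nbhd (free_nbr p) A|) (#|` nbhd (free_nbr spread) A|) => n m *.
nia.
Qed.

(** Induction on the size of [A]. Inside one translate of [layer R] the set expands as under [q]. If
    it has a gap between two consecutive layers around a copy, the parts [A1] and [A2] have disjoint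
    neighbourhoods and their counts add up. Otherwise each of the layers around a copy that it
    competes with brings a new element, and [many_cells] applies. *)
Lemma spread_good : exists K, good spread K.
Proof.
(* The ratio is 2 + 1/M inside one translate and 2 + 1/(2N) across several; [K] is at least [M] and
   at least [2 * N]. *)
have [K KE] : exists K, K = 2 * N + M by eexists.
exists K => A; have [n le_n] := ubnP #|` A|; elim: n => // n IH in A le_n *.
move=> Ahole.
have [[c [Dc Acell]]|not_one] := pselect (exists c, D' c /\
    (forall a, a \in A -> (c * a)%g \in layer R)).
  by apply: expanding_ratio_le (one_cell Dc Ahole Acell); lia.
have [[c [i [iR Dc cA nA gap]]]|no_gap] := pselect (exists c i,
   [/\ i < R, D' c, (exists2 a, a \in A & (c * a)%g \in layer i),
     (exists2 a, a \in A & (c * a)%g \notin layer i) &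
     (forall a, a \in A -> (c * a)%g \in layer i.+1 -> (c * a)%g \in layer i)]).
  have EA : cell c A i `|` (A `\` cell c A i) = A.
    by apply/fsetP => a; rewrite !inE; case: (a \in A) => //=; case:
      (_ \in layer i).
  set A1 := cell c A i in EA *; set A2 := A `\` A1 in EA.
  have card_A : #|` A| = #|` A1| + #|` A2|.
    by rewrite -(cardfsID A1 A) (fsetIidPr _) //; apply/fsubsetP => a;
      rewrite !inE => /andP[].
  have disj : nbhd (free_nbr spread) A1 `&` nbhd (free_nbr spread) A2 = fset0.
    apply/eqP; rewrite -fsubset0; apply/fsubsetP => t; rewrite in_fsetI.
    move=> /andP[/nbhdP[a aA1 /free_nbrP[[s sS ->] _]]].
    move=> /nbhdP[b bA2 /free_nbrP[[r rS E] _]]; exfalso.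
    move: aA1 bA2; rewrite !inE => /andP[aA ca] /andP[+ bA].
    rewrite bA /= => /negP; apply; apply: gap => //.
    have -> : (c * b = c * a * s * r^-1)%g by rewrite -(mulgA c a s) E mulgA
      mulgK.
    exact: layerS.
  rewrite -{2}EA nbhdU cardfsU disj cardfs0 subn0 card_A mulnDr mulnDr.
  have [a aA ca] := cA; have [b bA cb] := nA.
  have lt1 : 0 < #|` A1| by rewrite cardfs_gt0; apply/fset0Pn; exists a;
    rewrite !inE aA.
  have lt2 : 0 < #|` A2|.
    by rewrite cardfs_gt0; apply/fset0Pn; exists b; rewrite !inE bA (negPf cb).
  apply: leq_add; apply: IH; try lia.
    by move=> x; rewrite !inE => /andP[/Ahole].
  by move=> x; rewrite !inE => /andP[_ /Ahole].
apply: (@expanding_ratio_le (2 * N)); first lia.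
apply: many_cells => // c a Dc aA ca.
(* [A] meets [layer 0] and is not contained in [layer R], so two equal consecutive cells would be a
   gap. *)
suff: forall i, i <= R -> i <= #|` cell c A i| by apply.
elim=> // i IHi iR; apply: leq_ltn_trans (IHi (ltnW iR)) _.
apply: fproper_ltn_card; rewrite fproperEneq andbC; apply/andP; split.
  apply/fsubsetP => b; rewrite !inE => /andP[-> cb] /=.
  exact: layer_le (leqnSn i) _ cb.
apply/eqP => E; apply: no_gap; exists c, i; split=> //.
- exists a; [exact: aA|]; exact: (layer_le (leq0n i)).
- apply: contrapT => nA; apply: not_one; exists c; split=> // b bA.
  apply: (layer_le (ltnW iR)); apply/negPn/negP => cb; by apply: nA; exists b.
- by move=> b bA cb; have : b \in cell c A i;
    [rewrite E !inE bA|rewrite !inE bA].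
Qed.

End PeriodicFill.

(** * Toeplitz labelings along a chain of subgroups *)

Section Chain.
Local Open Scope fset_scope.
Local Open Scope nat_scope.
Variables (G : groupType) (Gam : nat -> set G).
Hypotheses (Gam_subgroup : forall n, subgroup (Gam n))
  (Gam_decr : forall n, (Gam n.+1 `<=` Gam n)%classic)
  (Gam_sep : forall g, g <> 1%g -> exists n, ~ Gam n g).

Lemma chain_le m n : m <= n -> (Gam n `<=` Gam m)%classic.
Proof.
elim: n => [|n IH]; first by rewrite leqn0 => /eqP->.
by rewrite leq_eqVlt => /orP[/eqP->//|/IH sub] g /Gam_decr /sub.
Qed.

Lemma chain_avoid n (E : seq G) :
  exists2 m, n <= m & forall c, Gam m c -> c \in E -> c = 1%g.
Proof.
elim: E => [|a E [m nm IH]]; first by exists n.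
have [->|/eqP/Gam_sep[k nk]] := eqVneq a 1%g.
  by exists m => // c mc; rewrite inE => /orP[/eqP|/(IH c mc)].
exists (maxn m k) => [|c mc]; first by rewrite leq_max nm.
rewrite inE => /orP[/eqP ca|]; last exact/IH/(chain_le (leq_maxl m k)).
by case: nk; rewrite -ca; apply: chain_le mc; exact: leq_maxr.
Qed.

Lemma countable_enum : countable [set: G]%classic ->
  exists e : nat -> G, forall g, exists n, e n = g.
Proof.
move=> /countable_injP[f finj].
exists (fun n => xget 1%g [set g | f g = n]%classic) => g; exists (f g).
by case: xgetP => [h _ /= fgh|/(_ g)[]//]; exact:
  finj (mem_set I) (mem_set I) fgh.
Qed.

(** Each stage labels the next element of an enumeration and passes to a subgroup further down the
    chain. A label once given is kept, and the stage at which it appears is periodic, so it recurs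
    along the subgroup of that stage. *)
Lemma paradoxical_labeling (S : {fset G}) (s0 : S) :
    countable [set: G]%classic ->
    (forall A : {fset G}, 3 * #|` A| <= #|` mulfs A S|) ->
  exists x : G -> {ffun bool -> S},
    (forall g, exists n, forall c, Gam n c -> x (c * g)%g = x g) /\
    (forall g h i j, (g * val (x g i) = h * val (x h j))%g -> g = h /\ i = j).
Proof.
move=> /countable_enum[e esurj] expS.
pose inv (pn : (G -> option {ffun bool -> S}) * nat) :=
  [/\ valid pn.1, periodic (Gam pn.2) pn.1 & exists N, good pn.1 N].
have inv0 : inv (fun _ => None, 0).
  (* Nothing is used yet, and 3 is the ratio 2 + 1/N for N = 1. *)
  split=> //; exists 1 => A _ /=; rewrite mul1n; apply: leq_trans (expS A) _.
  apply: fsubset_leq_card; apply/fsubsetP => t /mulfsP[a aA [s sS ->]].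
  apply/nbhdP; exists a => //; apply/free_nbrP; split; first by exists s.
  by move=> -[g [i []]].
have step (pn : {pn | inv pn}) g :
    {qm : {pn | inv pn} | extends (sval pn).1 (sval qm).1 /\ (sval qm).1 g}.
  apply: cid; case: pn => -[p n] /= pn_inv; have [/= vp pp [N gp]] := pn_inv.
  have [pg|/negP pg] := pselect (p g); first by exists (exist _ (p, n) pn_inv).
  have [F [q [M [gF FH qout qin [vq gq]]]]] := local_fill s0 vp gp pg.
  have [m nm sep] := chain_avoid n (spread_radius S F N).
  have mn := chain_le nm.
  have q_inv : inv (spread p q F (Gam m), m).
    split=> /=; first exact (spread_valid s0 pp vp qout qin vq (Gam_subgroup m)
      mn sep).
      exact (spread_periodic s0 _ pp (Gam_subgroup m) mn sep).
    exact (spread_good s0 pp gp FH qout qin vq gq (Gam_subgroup m) mn sep).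
  exists (exist _ _ q_inv); split=> /=; first exact (spread_extends _ pp FH mn).
  by rewrite (spread_base s0 p q (Gam_subgroup m) sep) // qin.
pose st := nat_rect (fun _ => {pn | inv pn}) (exist _ _ inv0)
  (fun n s => sval (step s (e n))).
have st_ext m n : m <= n -> extends (sval (st m)).1 (sval (st n)).1.
  elim: n => [|n IH]; first by rewrite leqn0 => /eqP->.
  rewrite leq_eqVlt => /orP[/eqP->//|/IH mn] h hm.
  have [nn _] := svalP (step (st n) (e n)).
  by have := mn h hm => E; rewrite -E; apply: nn; rewrite E.
have total g : exists n, (sval (st n)).1 g.
  have [n <-] := esurj g; exists n.+1; by have [] := svalP (step (st n) (e n)).
have total' g : exists l n, (sval (st n)).1 g = Some l.
  have [n] := total g; case E : (_ g) => [l|//] _; by exists l, n.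
have [x xP] := choice total'.
have xE n m g : n <= m -> (sval (st n)).1 g = Some (x g) ->
    (sval (st m)).1 g = Some (x g).
  by move=> nm E; rewrite (st_ext n m nm) E.
exists x; split=> [g|g h i j E].
  have [n gn] := xP g; have [_ per _] := svalP (st n).
  exists (sval (st n)).2 => c nc; have [m cgm] := xP (c * g)%g.
  have := xE _ _ _ (leq_maxl m n) cgm.
  have Ec : (sval (st n)).1 (c * g)%g = Some (x g) by rewrite per.
  by rewrite (st_ext n _ (leq_maxr m n)) Ec // => -[].
have [n gn] := xP g; have [m hm] := xP h.
have := xE _ _ _ (leq_maxl n m) gn; have := xE _ _ _ (leq_maxr n m) hm.
have [v _ _] := svalP (st (maxn n m)) => hE gE.
by apply: (v g h i j); rewrite /target ?gE ?hE.
Qed.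
End Chain.

(** * Expansion in non-amenable groups *)

Lemma ultra_fmap (T U : Type) (f : T -> U) (F : set_system T) :
  UltraFilter F -> UltraFilter (f @ F).
Proof.
move=> FU; split=> [|H HP FH]; first exact: fmap_proper_filter.
apply/funext => A; apply/propext; split=> [HA|]; last exact: FH.
have [//|FA] := in_ultra_setVsetC (f @^-1` A) FU.
have HnA : H (~` A) by apply: FH.
by exfalso; apply: (@filter_not_empty _ H); rewrite -(setICr A); exact: filterI.
Qed.

Section Folner.
Local Open Scope fset_scope.
Local Open Scope nat_scope.
Variables (R : realType) (G : groupType).
Hypothesis G_countable : countable [set: G]%classic.
Implicit Types (A B S : {fset G}).

Lemma mulfsA A B S : mulfs (mulfs A B) S = mulfs A (mulfs B S).
Proof.
apply/fsetP => t; apply/mulfsP/mulfsP.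
  move=> [_ /mulfsP[a aA [b bB ->]] [s sS ->]].
  by exists a => //; exists (b * s)%g; [apply/mulfsP; exists b => //;
    exists s | rewrite mulgA].
move=> [a aA [_ /mulfsP[b bB [s sS ->]] ->]].
by exists (a * b)%g; [apply/mulfsP; exists a => //; exists b | exists s => //;
  rewrite mulgA].
Qed.

Definition folner := forall S n, exists2 A, A != fset0 &
  n * #|` mulfs A S `\` A| <= #|` A|.

(** The mean is the limit of densities in Folner sets along a free ultrafilter. These sets are
    almost invariant on the right while the mean has to be invariant on the left, so the inverses of
    their elements are counted. *)
Lemma folner_amenable : folner -> amenable R G.
Proof.
move=> fol; have [e esurj] := countable_enum G_countable.
pose S n := [fset e i | i in iota 0 n].
have [A AP] := choice (fun n => let: ex_intro2 A A0 AS := fol (S n) n in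
  ex_intro (fun A => A != fset0 /\ n * #|` mulfs A (S n) `\` A| <= #|` A|) A
    (conj A0 AS)).
pose c (n : nat) (B : set G) := #|` [fset a in A n | `[< B (a^-1)%g >]]|.
pose r (B : set G) n : R := ((c n B)%:R / (#|` A n|)%:R)%R.
have A_gt0 n : (0 < (#|` A n|)%:R :> R)%R.
  by rewrite ltr0n cardfs_gt0; case: (AP n).
have [U [UU ooU]] := ultraFilterLemma (F := \oo%classic) _.
have r01 (B : set G) n : (0 <= r B n <= 1)%R.
  rewrite /r divr_ge0 ?ler0n //= ler_pdivrMr // mul1r ler_nat.
  by apply: fsubset_leq_card; apply/fsubsetP => a; rewrite !inE => /andP[].
have limex (B : set G) : exists l : R, (r B @ U --> l)%classic.
  have := @segment_compact R 0%R 1%R; rewrite compact_ultra.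
  move=> /(_ _ (ultra_fmap (r B) UU))[|l [_ rl]]; last by exists l.
  by apply: (@filterE _ U) => n; rewrite /= in_itv; exact: r01.
have [m mP] := choice limex.
have m_uniq (B : set G) l : (r B @ U --> l)%classic -> m B = l.
  by move=> rl; apply: (cvg_unique _ (mP B) rl); exact: norm_hausdorff.
(* If the inverse of [a] lies in [g * B], that of [a * g] lies in [B], and for large n at most |A n|
   / n of the elements [a * g] fall outside [A n]. The reverse inequality follows from [g^-1]. *)
have m_le (g : G) (B : set G) : (m [set (g * b)%g | b in B]%classic <= m B)%R.
  apply/ler_addgt0Pr => eps eps0.
  apply: (ler_cvg_to (mP _) (cvgD (mP B) (cvg_cst eps))).
  have [k ek] := esurj g.
  have [k' k'P] : exists k' : nat, (eps^-1 <= k'%:R)%R.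
    by exists (Num.truncn eps^-1).+1; apply/ltW/truncnS_gt.
  apply: ooU; exists (maxn k.+1 k') => // n /=;
    rewrite geq_max => /andP[kn k'n].
  rewrite /r /= -[X in (_ <= _ + X)%R](mulfK (lt0r_neq0 (A_gt0 n))) -mulrDl.
  rewrite ler_pM2r ?invr_gt0 //.
  have [_ AS] := AP n.
  have le : c n [set (g * b)%g | b in B]%classic
      <= c n B + #|` mulfs (A n) (S n) `\` A n|.
    have -> : c n [set (g * b)%g | b in B]%classic
        = #|` [fset (a * g)%g | a in
               [fset a in A n | `[< [set (g * b)%g | b in B]%classic
                   (a^-1)%g >]]]|.
      by rewrite card_imfset //; exact: mulIg.
    apply: leq_trans (leq_card_fsetU _ _); apply: fsubset_leq_card.
    apply/fsubsetP => _ /imfsetP[a /= + ->]; rewrite !inE.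
    move=> /andP[aA /asboolP[b Bb gb]].
    have -> /= : (a * g)%g \in mulfs (A n) (S n).
      apply/mulfsP; exists a => //; exists g => //; apply/imfsetP;
        exists k => //=.
      by rewrite mem_iota add0n.
    case: (_ \in A n) => //=; rewrite orbF; apply/asboolP.
    by rewrite invgM -gb mulKg.
  have : ((c n [set (g * b)%g | b in B]%classic)%:R
      <= (c n B)%:R + (#|` mulfs (A n) (S n) `\` A n|)%:R :> R)%R.
    by rewrite -natrD ler_nat.
  move=> /le_trans; apply; rewrite lerD2l -ler_pdivrMl //.
  apply: (@le_trans _ _ (n%:R * (#|` mulfs (A n) (S n) `\` A n|)%:R)%R).
    by rewrite ler_wpM2r ?ler0n // (le_trans k'P) // ler_nat.
  by rewrite -natrM ler_nat.
exists m; split.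
- move=> B; apply: (ler_cvg_to (cvg_cst 0%R) (mP B)).
  by apply: filterE => n; case/andP: (r01 B n).
- apply: m_uniq; rewrite (_ : r _ = cst 1%R); first exact: cvg_cst.
  apply/funext => n; rewrite /r /c (_ : [fset _ in _ | _] = A n).
    by rewrite divff // lt0r_neq0.
  by apply/fsetP => a; rewrite !inE andbC; case: asboolP => // -[].
- move=> B C BC; apply: m_uniq; rewrite (_ : r _ = r B \+ r C)%R.
    exact: cvgD.
  apply/funext => n; rewrite /r /= -mulrDl -natrD; congr (_%:R / _)%R.
  have BCn : [fset a in A n | `[< B (a^-1)%g >]] `&`
      [fset a in A n | `[< C (a^-1)%g >]] = fset0.
    apply/eqP; rewrite -fsubset0; apply/fsubsetP => a; rewrite !inE.
    move=> /andP[/andP[_ /asboolP Ba] /andP[_ /asboolP Ca]].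
    by have : (B `&` C)%classic (a^-1)%g by []; rewrite BC.
  rewrite /c -cardfsUI BCn cardfs0 addn0; congr #|` _|; apply/fsetP => a.
  rewrite !inE -andb_orr; congr (_ && _).
  by apply/asboolP/orP => -[] => [||/asboolP|/asboolP]; [left|right|left|right];
    first [exact/asboolP | done].
- move=> g B; apply/eqP; rewrite eq_le m_le /=.
  have := m_le (g^-1)%g [set (g * b)%g | b in B]%classic.
  rewrite (_ : [set (g^-1 * _)%g | _ in _]%classic = B) //.
  apply/seteqP; split=> [_ [_ [b Bb <-] <-]|b Bb]; first by rewrite mulKg.
  by exists (g * b)%g; [exists b | rewrite mulKg].
Qed.

(** Failure of the Folner condition makes every finite set grow by the factor 1 + 1/n once 1 is put
    into [S0]. By Bernoulli's inequality n steps at least double it, so 2n steps give a factor 4. *)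
Lemma nonamenable_expansion : ~ amenable R G ->
  exists S, S != fset0 /\ forall A, 3 * #|` A| <= #|` mulfs A S|.
Proof.
move=> nam; have : ~ folner by move/folner_amenable.
move=> /existsNP[S0 /existsNP[n nfol]].
pose S : {fset G} := 1%g |` S0.
have grow A : n.+1 * #|` A| <= n * #|` mulfs A S|.
  have [->|A0] := eqVneq A fset0; first by rewrite cardfs0 muln0.
  have : #|` A| + #|` mulfs A S0 `\` A| <= #|` mulfs A S|.
    rewrite -(cardfsID A (mulfs A S)); apply: leq_add; apply: fsubset_leq_card.
      apply/fsubsetP => a aA; rewrite in_fsetI aA andbT.
      by apply/mulfsP; exists a => //; exists 1%g; rewrite ?mulg1 // !inE eqxx.
    apply: fsetSD; apply/fsubsetP => t /mulfsP[a aA [s sS ->]].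
    by apply/mulfsP; exists a => //; exists s => //; rewrite !inE sS orbT.
  have : #|` A| < n * #|` mulfs A S0 `\` A|.
    by rewrite ltnNge; apply/negP => le; apply: nfol; exists A.
  nia.
pose Sn k := iter k (fun B => mulfs B S) [fset 1%g].
have growk k A : n.+1 ^ k * #|` A| <= n ^ k * #|` mulfs A (Sn k)|.
  elim: k => [|k IH].
    rewrite !expn0 !mul1n; apply: fsubset_leq_card; apply/fsubsetP => a aA.
    by apply/mulfsP; exists a => //; exists 1%g; rewrite ?mulg1 // inE.
  have := grow (mulfs A (Sn k)); rewrite mulfsA !expnS => le.
  rewrite -mulnA; apply: leq_trans (leq_mul (leqnn _) IH) _.
  by rewrite mulnCA [n * _]mulnC -mulnA; apply: leq_mul.
have n0 : 0 < n.
  have := grow [fset 1%g]; case: n {nfol growk grow} => //.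
  by rewrite mul0n cardfs1.
have ineq k : n ^ k + k * n ^ k.-1 <= n.+1 ^ k.
  elim: k => [|[|k] IH]; rewrite ?expn0 ?expn1 //=; first lia.
  move: IH; rewrite /= (expnS n.+1 k.+1) (expnS n k.+1) [n ^ k.+1]expnS => IH.
  nia.
have two : 2 * n ^ n <= n.+1 ^ n.
  by apply: leq_trans (ineq n);
    rewrite -{3}(prednK n0) -expnS prednK // mul2n addnn.
exists (Sn (n + n)); split; last first.
  move=> A; have := growk (n + n) A; rewrite !expnD => le.
  have : 0 < n ^ n by rewrite expn_gt0 n0.
  move: (n.+1 ^ n) (n ^ n) two le => u v two le v0.
  have uv : 4 * (v * v) <= u * u by nia.
  have := leq_trans (leq_mul uv (leqnn _)) le.
  rewrite mulnAC [v * v * _]mulnC leq_pmul2r; last by nia.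
  by apply: leq_trans; rewrite leq_mul2r orbT.
apply/fset0Pn; exists 1%g; elim: (n + n) => [|k IH]; first by rewrite inE.
by apply/mulfsP; exists 1%g => //; exists 1%g; rewrite ?mulg1 // !inE eqxx.
Qed.
End Folner.

(** * A bit recognizing cosets *)

(** [finite_index] counts left cosets; inverting their representatives gives representatives of the
    right ones. *)
Lemma right_transversal (G : groupType) (D : set G) :
  subgroup D -> finite_index D ->
  exists L : seq G, forall u, exists2 l, l \in L & D (u * l^-1)%g.
Proof.
move=> [D1 _ DV] /finite_seqP[s sE].
exists [seq (xget 1%g [set g | X = [set (g * a)%g | a in D]])^-1%g | X <- s] =>
  u.
have uX : [set (u^-1 * a)%g | a in D] \in s.
  by have := image_f (fun g => [set (g * a)%g | a in D]) (mem_set (I :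
    setT u^-1%g));
    rewrite sE => /set_mem.
exists (xget 1%g [set g | [set (u^-1 * a)%g | a in D] = [set (g * a)%g | a in
  D]])^-1%g.
  exact: map_f uX.
case: xgetP => [h _ /= E|/(_ u^-1%g)[]//]; rewrite invgK.
have : [set (u^-1 * a)%g | a in D] h by rewrite E; exists 1%g; rewrite ?mulg1.
by move=> [a Da <-]; rewrite mulKVg.
Qed.

Section Recognition.
Variables (G : groupType) (Gam : nat -> set G).
Hypotheses (G_countable : countable [set: G])
  (Gam_subgroup : forall n, subgroup (Gam n))
  (Gam_index : forall n, finite_index (Gam n))
  (Gam0 : Gam 0 = setT)
  (Gam_decr : forall n, Gam n.+1 `<=` Gam n)
  (Gam_strict : forall n, exists2 g, Gam n g & ~ Gam n.+1 g).

(* [b g] is the parity of the depth at which [g] leaves a nested sequence of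
   cosets with empty intersection. Among the cosets of [Gam n.+1] in the [n]-th
   one, the next one is the only one on which [b] takes both values. *)
Lemma recognizing_bit : exists b : G -> bool,
  (forall g, exists n, forall c, Gam n c -> b (c * g)%g = b g) /\
  (forall n, exists K : seq G, forall u v,
    {in K, forall k, b (u * k)%g = b (v * k)%g} -> Gam n (u * v^-1)%g).
Proof.
have [e esurj] := countable_enum G_countable.
have M n x y : Gam n x -> Gam n y -> Gam n (x * y)%g.
  by case: (Gam_subgroup n) => _ h _; exact: h.
have V n x : Gam n x -> Gam n (x^-1)%g by case: (Gam_subgroup n) => _ _; exact.
have one n : Gam n 1%g by case: (Gam_subgroup n).
(* The coset [Gam n * x] contains at least two cosets of [Gam n.+1]; [y] is taken in one that misses
   [e n], so the nested cosets [C n] have empty intersection. *)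
have next n x : {y | Gam n (y * x^-1)%g /\ ~ Gam n.+1 (e n * y^-1)%g}.
  apply: cid; have [g gn gSn] := Gam_strict n.
  have [ex|] := pselect (Gam n.+1 (e n * x^-1)%g); last first.
    by move=> nex; exists x; rewrite mulgV.
  exists (g * x)%g; rewrite mulgK; split=> // egx; apply: gSn.
  have := M _ _ _ (V _ _ egx) ex.
  by rewrite !invgM !invgK -!mulgA mulKg mulgV mulg1.
pose a := nat_rect (fun _ => G) 1%g (fun n x => sval (next n x)).
pose C n g := Gam n (g * (a n)^-1)%g.
have C_decr n g : C n.+1 g -> C n g.
  have [an _] := svalP (next n (a n)).
  by move=> /Gam_decr Cg; have := M _ _ _ Cg an; rewrite mulgA mulgVK.
have C_le m n g : (m <= n)%N -> C n g -> C m g.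
  elim: n => [|n IH]; first by rewrite leqn0 => /eqP->.
  by rewrite leq_eqVlt => /orP[/eqP->//|/IH h] /C_decr /h.
have C_out g : exists n, ~~ `[< C n g >].
  have [n <-] := esurj g; exists n.+1; apply/asboolPn.
  by have [_] := svalP (next n (a n)).
(* Always positive, because [C 0] is all of [G]. *)
pose depth g := ex_minn (C_out g).
have depthE n g : C n g -> ~ C n.+1 g -> depth g = n.+1.
  rewrite /depth; case: ex_minnP => d /asboolPn nd dmin Cn nCn.
  apply/eqP; rewrite eqn_leq dmin ?andTb; last exact/asboolPn.
  by rewrite ltnNge; apply/negP => dn; apply: nd; exact: C_le dn Cn.
have C_shift n c g : Gam n c -> C n (c * g)%g <-> C n g.
  move=> nc; rewrite /C -mulgA; split=> h; last exact: M.
  by have := M _ _ _ (V _ _ nc) h; rewrite mulKg.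
exists (fun g => odd (depth g)); split.
  move=> g; exists (depth g) => c.
  have : ~ C (depth g) g /\ (0 < depth g)%N /\ C (depth g).-1 g.
    rewrite /depth; case: ex_minnP => -[|d] /asboolPn nd dmin.
      by case: nd; rewrite /C Gam0.
    do 2!split=> //=; apply: contrapT => nCd.
    by have := dmin d (introT (asboolPn _) nCd); rewrite ltnn.
  case: (depth g) => [[_ []]|d [nC [_ /= Cd]] Dc] //; rewrite (depthE d) //.
    by apply/C_shift => //; exact: Gam_decr.
  by move=> /(C_shift _ _ _ Dc).
have shell n : exists c, C n c /\ ~ C n.+1 c.
  have [g gn gSn] := Gam_strict n; exists (g * a n.+1)%g; split;
    last by rewrite /C mulgK.
  have [an _] := svalP (next n (a n)).
  by rewrite /C -mulgA; exact: M.
elim=> [|n [K KP]]; first by exists [::] => u v _; rewrite Gam0.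
have [c [Cc nCc]] := shell n.+1.
have [L LP] := right_transversal (Gam_subgroup n.+2) (Gam_index n.+2).
(* For [l] representing [u], the test point [k = l^-1 * c] puts [u * k] into [C n.+1] but outside
   [C n.+2]. *)
exists (K ++ [seq (l^-1 * c)%g | l <- L]) => u v agree.
have uv : Gam n (u * v^-1)%g.
  by apply: KP => k kK; apply: agree; rewrite mem_cat kK.
have [l lL ul] := LP u; pose k := (l^-1 * c)%g.
have ukE : (u * k)%g = (u * l^-1 * c)%g by rewrite mulgA.
have Cuk : C n.+1 (u * k)%g by rewrite ukE; apply/C_shift => //; exact:
  Gam_decr.
have nCuk : ~ C n.+2 (u * k)%g by rewrite ukE; move/(C_shift _ _ _ ul).
have vkE : (v * k = (u * v^-1)^-1 * (u * k))%g.
  by rewrite invgM invgK -mulgA mulKg.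
have Cvk : C n (v * k)%g by rewrite vkE; apply/C_shift; [exact: V|exact:
  C_decr].
(* Otherwise the depths of [u * k] and [v * k] are n+2 and n+1, and the bits differ. *)
have CSvk : C n.+1 (v * k)%g.
  apply: contrapT => nCvk; have := agree k.
  rewrite (depthE _ _ Cuk nCuk) (depthE _ _ Cvk nCvk) /=.
  have -> : k \in K ++ [seq (l^-1 * c)%g | l <- L].
    by rewrite mem_cat (map_f (fun l => l^-1 * c)%g lL) orbT.
  move=> /(_ isT).
  by case: (odd n).
have divE (x y z w : G) : (x * z * w * (y * z * w)^-1 = x * y^-1)%g.
  by rewrite !invgM !mulgA !mulgK.
by have := M _ _ _ Cuk (V _ _ CSvk); rewrite divE.
Qed.
End Recognition.

(** * Invariant clopen partitions *)

(** [Q] is the quasi-component of [x], the intersection of its clopen neighbourhoods. In a compact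
    Hausdorff space it is connected, hence reduced to [x] here. *)
Lemma compact_totally_disconnected_clopen (R : realType) (T : topologicalType) :
  hausdorff_space T -> compact [set: T] -> totally_disconnected [set: T] ->
  zero_dimensional T.
Proof.
move=> hT cT tdT x y xy; apply: contrapT => nsep.
pose clx (D : set T) := clopen D /\ D x.
pose Q := [set z | forall D, clx D -> D z].
have Qx : Q x by move=> D [].
have Qy : Q y.
  by move=> D [cD Dx]; apply: contrapT => nDy; apply: nsep; exists D.
have cQ : closed Q.
  rewrite (_ : Q = \bigcap_(D in clx) D); first by apply: closed_bigI => D [[]].
  by apply/seteqP; split=> z h D /h.
(* By compactness, if every clopen neighbourhood of [x] met the complement of [W], so would [Q]. *)
have shrink W : open W -> Q `<=` W -> exists2 D, clx D & D `<=` W.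
  move=> oW QW; apply: contrapT => nD.
  pose F := filter_from clx (fun D => D `&` ~` W).
  have FF : ProperFilter F.
    apply: filter_from_proper; last first.
      move=> D Dx; apply: contrapT => /nonemptyPn DW; apply: nD; exists D => //.
      by move=> z Dz; apply: contrapT => nWz; have : (D `&` ~` W) z by [];
        rewrite DW.
    apply: filter_from_filter; first by exists setT; split=> //; exact: clopenT.
    move=> D E [cD Dx] [cE Ex]; exists (D `&` E); first by split=> //; exact:
      clopenI.
    by move=> z [[]].
  have [z [_ Fz]] : [set: T] `&` cluster F !=set0 by apply: cT; exact: filterT.
  have zcl A : F A -> closed A -> A z.
    by move=> FA cA; apply: cA => B zB; exact: Fz FA zB.
  have : (~` W) z.
    apply: zcl; last exact: open_closedC.
    by exists setT => [|w []//]; split=> //; exact: clopenT.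
  apply; apply: QW => D [[oD cD] Dx]; apply: zcl => //.
  by exists D => [|w []//]; split=> //; split.
have part A B : closed A -> closed B -> A `&` B = set0 -> Q = A `|` B -> A x ->
    B = set0.
  move=> cA cB AB QE Ax.
  have [U [V [oU oV AU BV UV]]] :=
    (normal_openP (R := R)).1 (compact_normal hT cT) A B cA cB AB.
  have [||D [[oD cD] Dx] DUV] := shrink (U `|` V); first exact: openU.
    by rewrite QE; exact: setUSS.
  (* [D] is covered by the disjoint open sets [U] and [V], so cutting it with [U] leaves a clopen
     set, and [Q] misses [V]. *)
  have DU : clx (D `&` U).
    split; last by split=> //; exact: AU.
    split; first exact: openI.
    rewrite (_ : D `&` U = D `&` ~` V); first exact:
      closedI cD (open_closedC oV).
    apply/seteqP; split=> z [Dz].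
      by move=> Uz; split=> // Vz; have : (U `&` V) z by []; rewrite UV.
    by move=> nV; split=> //; case: (DUV z Dz).
  rewrite -subset0 => z Bz; have Qz : Q z by rewrite QE; right.
  have [_ Uz] := Qz _ DU; have : (U `&` V) z by split=> //; exact: BV.
  by rewrite UV.
have conQ : connected Q.
  move=> B B0 [W oW BO] [K cK BK].
  have cB : closed B by rewrite BK; exact: closedI.
  have cnB : closed (Q `&` ~` W) by apply: closedI => //; exact: open_closedC.
  have dis : B `&` (Q `&` ~` W) = set0.
    by rewrite -subset0 BO => z [[_ Oz] [_]].
  have QE : Q = B `|` (Q `&` ~` W) by rewrite BO -setIUr setUv setIT.
  have [Bx|nBx] := pselect (B x).
    by rewrite [RHS]QE (part _ _ cB cnB dis QE Bx) setU0.
  have B00 : B = set0.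
    apply: (part (Q `&` ~` W) B cnB cB);
      [by rewrite setIC | by rewrite setUC |].
    by move: Qx; rewrite {1}QE => -[/nBx|].
  by move: B0; rewrite B00 => -[].
have : connected_component [set: T] x y by exists Q.
by rewrite tdT // => /= yx; move: xy; rewrite yx eqxx.
Qed.

Lemma finite_nbhs_cover (T : topologicalType) (V : T -> set T) :
  compact [set: T] -> (forall z, nbhs z (V z)) ->
  exists L : seq T, forall x, exists2 z, z \in L & V z x.
Proof.
move=> cT Vz.
pose F := filter_from setT (fun s0 : seq T => [set s :
  seq T | {subset s0 <= s}]).
have FF : Filter F.
  apply: filter_from_filter; first by exists [::].
  move=> s t _ _; exists (s ++ t) => // u sub; split=> z zs; apply: sub;
  by rewrite mem_cat zs ?orbT.
pose P (s : seq T) x := exists2 z, z \in s & V z x.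
have near_P x : [set: T] x -> \forall x' \near x & s \near F, P s x'.
  move=> _; exists (V x, [set s | x \in s]); first split => //=.
    by exists [:: x] => // s /= sub; apply: sub; rewrite inE.
  by move=> [w s] /= [Vw Vs]; exists x.
have [s _ /(_ s (fun _ => id)) sP] :=
  (iffLR (compact_near_coveringP _) cT) _ _ P FF near_P.
by exists s => x; exact: sP.
Qed.

Section CompactMetric.
Variables (R : realType) (Z : metricType R).
Hypothesis Z_compact : compact [set: Z].

(** A Lebesgue number of the cover by [U] and its complement. *)
Lemma clopen_uniform (U : set Z) : clopen U ->
  exists2 d : R, (0 < d)%R & forall x y, (mdist x y < d)%R -> U x -> U y.
Proof.
move=> [oU cU].
have oD (x : Z) : exists2 r : R, (0 < r)%R & forall y, (mdist x y < r)%R -> U x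
  <-> U y.
  have [Ux|nUx] := pselect (U x).
    have /nbhs_ballP[r /= r0 rU] : nbhs x U by exact: open_nbhs_nbhs.
    exists r => // y xy; split=> // _; apply: rU; by rewrite ballEmdist.
  have /nbhs_ballP[r /= r0 rU] : nbhs x (~` U).
    by apply: open_nbhs_nbhs; split=> //; exact: closed_openC.
  exists r => // y xy; split=> // Uy; exfalso; apply: (rU y) => //.
  by rewrite ballEmdist.
pose P (e : R) (x : Z) := forall y, (mdist x y < e)%R -> U x -> U y.
have near_P x : [set: Z] x -> \forall x' \near x & e \near 0%R^'+, P e x'.
  move=> _; have [r r0 rU] := oD x; have r2 : (0 < r / 2)%R by rewrite divr_gt0.
  exists (ball x (r / 2), [set e | (e < r / 2)%R]); first split => /=.
  - exact: nbhsx_ballx.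
  - exact: nbhs_right_lt.
  move=> [x' e] /= []; rewrite ballEmdist /= => xx' er y x'y Ux'.
  apply/(rU y); last by apply/(rU x');
    rewrite ?(lt_trans xx') // ltr_pdivrMr // ltr_pMr // ltr1n.
  rewrite (splitr r); apply: le_lt_trans (metric_triangle x x' y) _.
  by rewrite ltrD // (lt_trans x'y).
have nP := (iffLR (compact_near_coveringP _) Z_compact) _ _ P _ near_P.
have [e [/= e0 eP]] := filter_ex (filterI (nbhs_right_gt (0%R : R)) (nP _)).
by exists e => // x y; exact: eP.
Qed.

Lemma small_clopen_cover (e : R) : zero_dimensional Z -> (0 < e)%R ->
  exists2 s : seq (set Z), {in s, forall U, clopen U} &
    forall z, exists2 U, U \in s & U z /\
      forall x y, U x -> U y -> (mdist x y < e)%R.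
Proof.
move=> zd e0.
have hZ : hausdorff_space Z by exact: metric_hausdorff.
have ball_clopen z : exists U : set Z, [/\ clopen U, U z &
    forall x y, U x -> U y -> (mdist x y < e)%R].
  have := zero_dimensional_cvg (x := z) hZ zd Z_compact.
  have e2 : (0 < e / 2)%R by rewrite divr_gt0.
  move=> /(_ _ (nbhsx_ballx z _ e2)) [U [Uz cU] Ub]; exists U;
    split=> // x y Ux Uy.
  have := Ub x Ux; have := Ub y Uy; rewrite !ballEmdist /= => zy zx.
  rewrite (splitr e); apply: le_lt_trans (metric_triangle x z y) _.
  by rewrite ltrD // metric_sym.
have [V VP] := choice ball_clopen.
have [L LP] := finite_nbhs_cover Z_compact (fun z =>
  let: And3 (conj oV _) Vz _ := VP z in open_nbhs_nbhs (conj oV Vz)).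
exists [seq V z | z <- L] => [_ /mapP[z _ ->]|z]; first by case: (VP z).
have [y yL Vyz] := LP z; exists (V y); first exact: map_f.
by have [_ _] := VP y.
Qed.
End CompactMetric.

(** * Chains of invariant partitions and their return groups *)

Section InvariantRelations.
Variables (R : realType) (G : groupType) (Z : metricType R) (c : G -> Z -> Z).
Hypotheses (Z_system : dynamical_system c) (Z_cantor : cantor_set Z)
  (Z_minimal : minimal_system c) (Z_equicontinuous : unif_equicontinuous c).

(** The last clause makes the classes uniformly open; by compactness they are finitely many clopen
    sets. *)
Definition invariant_equivalence (Q : Z -> Z -> Prop) :=
  [/\ forall x, Q x x, forall x y, Q x y -> Q y x,
      forall y x z, Q x y -> Q y z -> Q x z,
      forall g x y, Q x y -> Q (c g x) (c g y) &
      exists2 d : R, (0 < d)%R & forall x y, (mdist x y < d)%R -> Q x y].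

Lemma invariant_equivalenceI (P Q : Z -> Z -> Prop) :
  invariant_equivalence P -> invariant_equivalence Q ->
  invariant_equivalence (fun x y => P x y /\ Q x y).
Proof.
move=> [P1 P2 P3 P4 [d d0 P5]] [Q1 Q2 Q3 Q4 [e e0 Q5]]; split=> //.
- by move=> x y [/P2 ? /Q2].
- by move=> y x z [Pxy Qxy] [Pyz Qyz]; split; [exact: P3 Pyz|exact: Q3 Qyz].
- by move=> g x y [Pxy Qxy]; split; [exact: P4|exact: Q4].
exists (Num.min d e) => [|x y]; first by rewrite lt_min d0.
by rewrite lt_min => /andP[xd xe]; split; [exact: P5|exact: Q5].
Qed.

(** Two points are related when all their translates lie in the same members of a small clopen
    cover. Equicontinuity gives one radius that serves all translates. *)
Lemma fine_invariant_equivalence (e : R) : (0 < e)%R ->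
  exists2 Q, invariant_equivalence Q & forall x y, Q x y -> (mdist x y < e)%R.
Proof.
move=> e0; have [_ cZ tdZ _] := Z_cantor; have [_ _ [c1 cM] _] := Z_system.
have zd := compact_totally_disconnected_clopen R (@metric_hausdorff _ Z) cZ tdZ.
have [s sclopen sP] := small_clopen_cover cZ zd e0.
have [d d0 sd] : exists2 d : R, (0 < d)%R & forall U, U \in s -> forall x y,
    (mdist x y < d)%R -> U x -> U y.
  elim: s sclopen {sP} => [_|U s IH sclopen]; first by exists 1%R.
  have [|d d0 dP] := IH; first by move=> V Vs; apply: sclopen;
    rewrite inE Vs orbT.
  have [d' d'0 d'P] := clopen_uniform cZ (sclopen U (mem_head _ _)).
  exists (Num.min d d') => [|V]; first by rewrite lt_min d0.
  rewrite inE => /orP[/eqP->|Vs] x y; rewrite lt_min => /andP[xd xd'].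
    exact: d'P.
  exact: dP.
exists (fun x y => forall U g, U \in s -> U (c g x) <-> U (c g y)); last first.
  move=> x y xy; have [U Us [Ux Ud]] := sP x; apply: Ud => //.
  by have := xy U 1%g Us; rewrite !c1 => -[+ _]; apply.
split=> //.
- by move=> x y xy U g Us; split=> /(xy U g Us).
- by move=> y x z xy yz U g Us;
    split=> [/(xy U g Us)/(yz U g Us)|/(yz U g Us)/(xy U g Us)].
- by move=> g x y xy U h Us; rewrite -!cM; exact: xy.
have [d' d'0 dd'] := Z_equicontinuous d0; exists d' => // x y xy U g Us.
have gxy := dd' _ _ xy g.
by split; apply: sd => //; rewrite metric_sym.
Qed.

Lemma invariant_equivalence_finite Q : invariant_equivalence Q ->
  exists L : seq Z, forall x, exists2 z, z \in L & Q z x.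
Proof.
move=> [_ _ _ _ [d d0 dQ]]; have [_ cZ _ _] := Z_cantor.
apply: finite_nbhs_cover => // z; apply/nbhs_ballP; exists d => //= x.
by rewrite ballEmdist; exact: dQ.
Qed.

Variable z0 : Z.

(** Each new relation has mesh below both 1/(n+1) and the distance from [z0] to some return point
    [c g z0] in its old class. Such a point exists because [z0] is not isolated and its orbit is
    dense; it makes the refinement strict at [z0]. *)
Lemma equivalence_chain : exists E : nat -> Z -> Z -> Prop,
  [/\ forall n, invariant_equivalence (E n),
      forall x y, E 0 x y,
      forall n x y, E n.+1 x y -> E n x y,
      forall e : R, (0 < e)%R ->
        exists n, forall x y, E n x y -> (mdist x y < e)%R &
      forall n, exists g, E n (c g z0) z0 /\ ~ E n.+1 (c g z0) z0].
Proof.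
have return_ (d : R) : (0 < d)%R -> exists g, (mdist (c g z0) z0 < d)%R /\ c g
  z0 <> z0.
  move=> d0; have [_ _ _ iso] := Z_cantor.
  have [z zd zz0] : exists2 z, (ball z0 d)^° z & z <> z0.
    apply: contrapT => nz; suff : isolated [set: Z] z0 by rewrite iso.
    have zd : nbhs z0 (ball z0 d)^° by apply/nbhs_interior/nbhsx_ballx.
    split; first exact: mem_set.
    exists (ball z0 d)^° => //.
    rewrite setIT; apply/seteqP; split=> [z zd'|_ ->]; last exact:
      nbhs_singleton.
    by apply: contrapT => zz0; apply: nz; exists z.
  have [||x [[xd xz0] [g _ gx]]] := Z_minimal z0 (O := (ball z0 d)^° `&` ~`
    [set z0]).
  - by exists z.
  - apply: openI; first exact: open_interior.
    apply/closed_openC/accessible_closed_set1/hausdorff_accessible.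
    exact: metric_hausdorff.
  exists g; rewrite gx; split=> //.
  by have := interior_subset xd; rewrite ballEmdist /= metric_sym.
have step (E : {E | invariant_equivalence E}) (n : nat) : {F :
  {E | invariant_equivalence E} |
    [/\ forall x y, sval F x y -> sval E x y,
      forall x y, sval F x y -> (mdist x y < n.+1%:R^-1)%R &
      exists g, sval E (c g z0) z0 /\ ~ sval F (c g z0) z0]}.
  apply: cid; case: E => E iE /=.
  have [_ _ _ _ [d d0 dE]] := iE; have [g [gd gz0]] := return_ d d0.
  have e0 : (0 < Num.min n.+1%:R^-1 (mdist (c g z0) z0))%R.
    by rewrite lt_min invr_gt0 ltr0n /= mdist_gt0; apply/eqP.
  have [Q iQ Qe] := fine_invariant_equivalence e0.
  exists (exist _ _ (invariant_equivalenceI iE iQ));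
    split => /= [x y []//|x y [_ /Qe]|].
    by rewrite lt_min => /andP[].
  exists g; split; first exact: dE.
  by move=> [_ /Qe]; rewrite lt_min ltxx andbF.
have triv : invariant_equivalence (fun _ _ => True) by split=> //; exists 1%R.
pose st := nat_rect (fun _ => {E | invariant_equivalence E}) (exist _ _ triv)
  (fun n E => sval (step E n)).
exists (fun n => sval (st n)); split=> //.
- by move=> n; exact: svalP (st n).
- by move=> n x y; have [h _ _] := svalP (step (st n) n); exact: h.
- move=> e e0; exists (Num.truncn e^-1%R).+1 => x y.
  have [_ h _] := svalP (step (st (Num.truncn e^-1%R)) (Num.truncn e^-1%R)).
  move=> /h /lt_trans; apply; rewrite invf_plt ?posrE ?ltr0n //.
  exact: truncnS_gt.
- by move=> n; have [_ _ h] := svalP (step (st n) n).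
Qed.

Variable E : nat -> Z -> Z -> Prop.
Hypothesis E_equiv : forall n, invariant_equivalence (E n).

(** The stabilizer of the [E n]-class of [z0]; its left cosets correspond to the classes met by the
    orbit, whence the finite index. *)
Definition return_group n : set G := [set g | E n (c g z0) z0].

Lemma return_groupP n g h : return_group n (g^-1 * h)%g <-> E n (c h z0) (c g
  z0).
Proof.
have [_ _ [c1 cM] _] := Z_system; have [_ _ _ inv _] := E_equiv n.
rewrite /return_group /=; split=> [/(inv g)|/(inv g^-1%g)].
  by rewrite -cM mulKVg.
by rewrite -!cM mulVg c1.
Qed.

Lemma return_group_subgroup n : subgroup (return_group n).
Proof.
have [_ _ [c1 cM] _] := Z_system; have [refl sym trans inv _] := E_equiv n.
split=> [|a b aE bE|a aE]; rewrite /return_group /=.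
- by rewrite c1; exact: refl.
- by rewrite cM; apply: trans aE; exact: inv.
- by have := inv a^-1%g _ _ aE; rewrite -cM mulVg c1; exact: sym.
Qed.

Lemma return_group_index n : finite_index (return_group n).
Proof.
have [refl sym trans inv _] := E_equiv n.
have [L LP] := invariant_equivalence_finite (E_equiv n).
apply: (@sub_finite_set _ _ ((fun z => [set a | E n (c a z0) z]) @` [set` L]));
  last first.
  exact/finite_image/finite_seq.
move=> _ [g _ <-]; have [z zL zg] := LP (c g z0); exists z => //.
apply/seteqP; split=> [a /= az|_ [b bn <-]] /=.
  exists (g^-1 * a)%g; last by rewrite mulKVg.
  by apply/return_groupP; exact: trans az zg.
apply: trans (sym _ _ zg); apply/return_groupP; by rewrite mulKg.
Qed.
End InvariantRelations.

(** * Orbit closures in the full shift *)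

Section FullShift.
Variables (G : groupType) (A : finType).
Implicit Types (y w : full_shift G A) (W : seq G).

Lemma nbhs_window y (U : set (full_shift G A)) :
  nbhs y U <-> exists W, forall w, {in W, w =1 y} -> U w.
Proof.
have yF : Filter (nbhs y) by exact: nbhs_filter.
split; last first.
  move=> [W WU]; apply: (filterS WU); elim: W {WU} => [|g W IH].
    by apply: filterE => w g; rewrite in_nil.
  have Ng : nbhs y [set w : full_shift G A | w g = y g].
    have : nbhs (y g : discrete_topology A) [set y g].
      by apply: open_nbhs_nbhs; split => //; exact: discrete_open.
    exact: (@proj_continuous G (fun=> discrete_topology A) g y).
  apply: filterS (filterI Ng IH) => w [/= wg wW] k.
  by rewrite inE => /orP[/eqP->//|/wW].
pose F : set_system (full_shift G A) :=
  filter_from setT (fun W => [set w : full_shift G A | {in W, w =1 y}]).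
have FF : Filter F.
  apply: filter_from_filter; first by exists [::].
  move=> V W _ _; exists (V ++ W) => // w wy; split=> k kV; apply: wy;
  by rewrite mem_cat kV ?orbT.
suff Fy : F --> y by move=> /Fy [W _ WU]; exists W.
apply/cvg_sup => g V [_ [[B oB <-] /= Byg] BV].
exists [:: g] => // w wy; apply: BV => /=.
by rewrite /= (wy g) // inE.
Qed.

Lemma nbhs_subshift_window (X : subshift G A) (u : set_type X) (U :
  set (set_type X)) :
  nbhs u U <-> exists W, forall v : set_type X, {in W, val v =1 val u} -> U v.
Proof.
split.
  move=> [_ [[B oB <-] Bu] BU].
  have /nbhs_window[W WB] : nbhs (val u) B by exact: open_nbhs_nbhs.
  by exists W => v /WB Bv; exact: BU.
move=> [W WU].
have N : nbhs (set_val u) [set w : full_shift G A | {in W, w =1 val u}].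
  by apply/nbhs_window; exists W => w; rewrite set_valE.
have uF : Filter (nbhs u) by exact: nbhs_filter.
have := @initial_continuous _ _ (@set_val _ X) u _ N.
by apply: (@filterS _ (nbhs u) uF) => v; exact: WU.
Qed.

Lemma full_shift_compact : compact [set: full_shift G A].
Proof.
have := @tychonoff G (fun=> discrete_topology A) (fun=> setT).
rewrite (_ : [set f | _] = [set: full_shift G A]); last by apply/seteqP; split.
by apply=> _; apply: finite_compact; exact: finite_finset.
Qed.

Variable x : full_shift G A.

Lemma closure_orbitP y :
  closure (range ((@gshift G A)^~ x)) y <->
  forall W, exists g, {in W, gshift g x =1 y}.
Proof.
split=> [cy W|h U /nbhs_window[W WU]].
  have /cy[_ [[g _ <-] gW]] : nbhs y [set w : full_shift G A | {in W, w =1 y}].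
    by apply/nbhs_window; exists W.
  by exists g.
by have [g gW] := h W; exists (gshift g x); split; [exists g | exact: WU].
Qed.

Lemma orbit_closure_invariant h y :
  closure (range ((@gshift G A)^~ x)) y ->
  closure (range ((@gshift G A)^~ x)) (gshift h y).
Proof.
move=> /closure_orbitP yP; apply/closure_orbitP => W.
have [g gW] := yP [seq (h^-1 * k)%g | k <- W]; exists (h * g)%g => k kW.
have := gW _ (map_f (fun k => h^-1 * k)%g kW).
by rewrite /gshift invgM mulgA.
Qed.

Definition orbit_closure : subshift G A :=
  Subshift (@closed_closure _ (range ((@gshift G A)^~ x)))
    orbit_closure_invariant.

Lemma orbit_closureP (w : set_type orbit_closure) W :
  exists g, {in W, gshift g x =1 val w}.
Proof. by have /set_mem/closure_orbitP := valP w. Qed.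

Lemma orbit_point_subproof : x \in subshift_set orbit_closure.
Proof.
apply/mem_set/subset_closure; exists 1%g => //.
by apply/funext => g; rewrite /gshift invg1 mul1g.
Qed.
End FullShift.

(** * The factor map onto Z and its maximality *)

Section MaximalFactor.
Variables (R : realType) (G : groupType) (Z : metricType R) (c : G -> Z -> Z).
Hypotheses (Z_system : dynamical_system c) (Z_minimal : minimal_system c)
  (Z_equicontinuous : unif_equicontinuous c).
Variables (z0 : Z) (E : nat -> Z -> Z -> Prop).
Hypotheses (E_equiv : forall n, invariant_equivalence c (E n))
  (E_decr : forall n y z, E n.+1 y z -> E n y z)
  (E_mesh : forall e : R, (0 < e)%R ->
     exists n, forall y z, E n y z -> (mdist y z < e)%R).
Let Gam := return_group c z0 E.
Variables (A : finType) (x : full_shift G A) (K : nat -> seq G).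
Hypotheses (x_periodic : forall g, exists n, forall a, Gam n a -> x (a * g)%g =
  x g)
  (x_recognizes : forall n u v,
     {in K n, forall k, x (u * k)%g = x (v * k)%g} -> Gam n (u * v^-1)%g).

Let X := orbit_closure x.
Let o : set_type X := exist _ x (orbit_point_subproof x).
Let act : G -> set_type X -> set_type X := @subshift_act G A X.

Let E_refl n z : E n z z. Proof. by case: (E_equiv n). Qed.
Let E_sym n y z : E n y z -> E n z y. Proof. by case: (E_equiv n) => _ h _ _ _;
  exact: h. Qed.
Let E_trans n w y z : E n y w -> E n w z -> E n y z.
Proof. by case: (E_equiv n) => _ _ h _ _; exact: h. Qed.
Let E_act n g y z : E n y z -> E n (c g y) (c g z).
Proof. by case: (E_equiv n) => _ _ _ h _; exact: h. Qed.

Let E_le m n y z : (m <= n)%N -> E n y z -> E m y z.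
Proof.
elim: n => [|n IH]; first by rewrite leqn0 => /eqP->.
by rewrite leq_eqVlt => /orP[/eqP->//|/IH h] /E_decr /h.
Qed.

Let E_nbhs n z : nbhs z [set w | E n z w].
Proof.
have [_ _ _ _ [d d0 dE]] := E_equiv n; apply/nbhs_ballP; exists d => //= w.
by rewrite ballEmdist; exact: dE.
Qed.

Let E_separated y z : (forall n, E n y z) -> y = z.
Proof.
move=> yz; apply/eqP/negPn/negP;
  rewrite -mdist_gt0 => /E_mesh[n /(_ _ _ (yz n))].
by rewrite ltxx.
Qed.

Let recognize n g h : {in K n, gshift g x =1 gshift h x} ->
  E n (c g z0) (c h z0).
Proof.
move=> gh; apply/(return_groupP Z_system z0 E_equiv).
have := @x_recognizes n h^-1%g g^-1%g; rewrite invgK; apply => k kK.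
exact: esym (gh k kK).
Qed.

(** The graph of the factor map: the window [K n] of [w] determines the [E n]-class of [z], and
    these classes shrink to a point. *)
Let over (w : set_type X) z :=
  forall n g, {in K n, gshift g x =1 val w} -> E n z (c g z0).

Let over_inj (w : set_type X) y z : over w y -> over w z -> y = z.
Proof.
move=> wy wz; apply: E_separated => n; have [g gw] := orbit_closureP w (K n).
by apply: E_trans (wy n g gw) (E_sym (wz n g gw)).
Qed.

Let over_ex (w : set_type X) : exists z, over w z.
Proof.
have [_ cZ _ _] := Z_system.
have gP n : exists g, forall m, (m <= n)%N -> {in K m, gshift g x =1 val w}.
  have [g gw] := orbit_closureP w (flatten [seq K m | m <- iota 0 n.+1]).
  exists g => m mn k kK; apply: gw; apply/flattenP; exists (K m) => //.
  by apply: map_f; rewrite mem_iota.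
have [g gw] := choice gP.
(* A cluster point of the [c (g n) z0], where [g n] moves [x] to agree with [w] on the windows up to
   [K n]. *)
have [z [_ zc]] := cZ ((fun n => c (g n) z0) @ \oo) _ filterT.
exists z => n h hw; have [_ [[m nm <-] Ez]] : [set c (g m) z0 | m in [set m |
  (n <= m)%N]] `&`
    [set w | E n z w] !=set0.
  apply: zc (E_nbhs n z).
  by exists n => // m nm; exists m.
apply: E_trans Ez (recognize _) => k kK.
by rewrite (gw m n nm k kK) (hw k kK).
Qed.

Let p w := xget z0 (over w).
Let pP (w : set_type X) : over w (p w). Proof. by exact:
  (xgetPex z0 (over_ex w)). Qed.

Let p_orbit (w : set_type X) n (W : seq G) : exists g,
  {in W, gshift g x =1 val w} /\ E n (p w) (c g z0).
Proof.
have [g gw] := orbit_closureP w (W ++ K n); exists g; split.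
  by move=> k kW; apply: gw; rewrite mem_cat kW.
by apply: pP => k kK; apply: gw; rewrite mem_cat kK orbT.
Qed.

Let p_act g (w : set_type X) : p (act g w) = c g (p w).
Proof.
suff H : over (act g w) (c g (p w)) by exact: (over_inj (@pP (act g w)) H).
move=> n h hw.
have [b [bw pb]] := p_orbit w n [seq (g^-1 * k)%g | k <- K n].
have [_ _ [_ cM] _] := Z_system.
apply: E_trans (E_act g pb) _; rewrite -cM; apply: recognize => k kK.
rewrite hw //= {1}/gshift invgM -mulgA.
exact: (bw _ (map_f (fun k => g^-1 * k)%g kK)).
Qed.

Let p_continuous : continuous p.
Proof.
move=> w U /nbhs_ballP[e /= e0 eU]; have [n nE] := E_mesh e0.
suff : nbhs w (p @^-1` U) by [].
apply/nbhs_subshift_window; exists (K n) => v vw; apply: eU; rewrite ballEmdist.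
apply: nE; have [g gw] := orbit_closureP w (K n).
apply: E_trans (pP gw) (E_sym _); apply: pP => k kK.
by rewrite gw // vw.
Qed.

Let p_surj z : exists w, p w = z.
Proof.
have gP n : exists g, E n z (c g z0).
  have [||w [zw [g _ gz]]] := Z_minimal z0 (O := [set w | E n z w]^°).
  - by exists z; apply: nbhs_singleton; exact/nbhs_interior.
  - exact: open_interior.
  by exists g; rewrite gz; exact: interior_subset zw.
have [g gz] := choice gP.
have [y [_ yc]] := full_shift_compact (F := (fun n => gshift (g n) x) @ \oo) _
  filterT.
have near n (W : seq G) : exists2 m, (n <= m)%N & {in W, gshift (g m) x =1 y}.
  have [_ [[m nm <-] mW]] : [set gshift (g m) x | m in [set m | (n <= m)%N]] `&`
      [set w : full_shift G A | {in W, w =1 y}] !=set0.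
    apply: yc; first by exists n => // m nm; exists m.
    by apply/nbhs_window; exists W.
  by exists m.
have Xy : y \in subshift_set X.
  apply/mem_set/closure_orbitP => W; have [m _ mW] := near 0%N W.
  by exists (g m).
exists (exist _ y Xy); apply: E_separated => n; have [m nm mK] := near n (K n).
apply: E_trans (pP _) (E_sym _); first exact: mK.
exact: E_le nm (gz m).
Qed.

(** Near [o] an equicontinuous factor map [f] is controlled by a window on which [x] is
    [Gam n]-periodic. Equicontinuity carries this along the orbit, so points with [E n]-related
    images under [p] have close images under [f]. This gives both constancy on the fibers of [p] and
    continuity of the induced map. *)
Lemma orbit_closure_maximal_factor :
  maximal_equicontinuous_factor (@subshift_act G A X) c.
Proof.
split=> //; exists p => [|Y b [_ _ [b1 bM] _] Y_equi f [fc fs fE]].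
  by split=> // g w; exact: p_act.
have act_o g : val (act g o) = gshift g x by [].
have close (e : R) : (0 < e)%R -> exists n, forall v w : set_type X,
    E n (p v) (p w) -> (mdist (f v) (f w) < e)%R.
  move=> e0; have e3 : (0 < e / 3)%R by rewrite divr_gt0.
  have [d d0 dP] := Y_equi _ e3.
  have window (w : set_type X) (r : R) : (0 < r)%R -> exists W : seq G,
      forall v : set_type X, {in W, val v =1 val w} -> (mdist (f w) (f v) <
        r)%R.
    move=> r0; have /fc/nbhs_subshift_window[W WP] := nbhsx_ballx (f w) r r0.
    by exists W => v /WP /=; rewrite ballEmdist.
  have [W WP] := window o d d0.
  have [n nW] : exists n, forall a, Gam n a -> {in W, forall k, x (a * k)%g = x
    k}.
    elim: W {WP} => [|k W [n IH]]; first by exists 0%N.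
    have [m mk] := x_periodic k; exists (maxn m n) => a aG l.
    rewrite inE => /orP[/eqP->|lW].
      by apply: mk; exact: E_le (leq_maxl m n) aG.
    by apply: IH => //; exact: E_le (leq_maxr m n) aG.
  exists n => v w vw.
  have [V VP] := window v _ e3; have [U UP] := window w _ e3.
  have [g [gv pg]] := p_orbit v n V; have [h [hw ph]] := p_orbit w n U.
  have gh : E n (c h z0) (c g z0).
    exact: E_trans (E_sym ph) (E_trans (E_sym vw) pg).
  (* [g^-1 * h] returns [z0] to its class, so it moves [o] to a point with the same window [W]; then
     [g] is applied. *)
  have fgh : (mdist (f (act g o)) (f (act h o)) < e / 3)%R.
    have ao : (mdist (f o) (f (act (g^-1 * h)%g o)) < d)%R.
      apply: WP => k kW; rewrite act_o /gshift; apply: nW => //.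
      by rewrite invgM invgK; apply/(return_groupP Z_system z0 E_equiv)/E_sym.
    by have := dP _ _ ao g; rewrite (fE (g^-1 * h)%g) -bM mulKVg -!fE.
  apply: le_lt_trans (metric_triangle _ (f (act g o)) _) _.
  have fv := VP (act g o) gv; have fw := UP (act h o) hw.
  rewrite [e](_ : _ = e / 3 + (e / 3 + e / 3))%R; last by lra.
  apply: ltrD fv _; apply: le_lt_trans (metric_triangle _ (f (act h o)) _) _.
  by apply: ltrD fgh _; rewrite metric_sym.
have f_fiber v w : p v = p w -> f v = f w.
  move=> vw; apply/eqP/negPn/negP; rewrite -mdist_gt0 => /close[n].
  by move=> /(_ v w); rewrite vw ltxx => /(_ (E_refl _ _)).
have [s sP] := choice p_surj.
have hp w : f (s (p w)) = f w by apply: f_fiber; rewrite sP.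
exists (f \o s); last by apply/funext => w /=; rewrite hp.
split.
- move=> z U /nbhs_ballP[e /= e0 eU]; have [n nE] := close e e0.
  apply: filterS (E_nbhs n z) => y zy; apply: eU; rewrite ballEmdist /=.
  by apply: nE; rewrite !sP.
- by move=> y; have [w <-] := fs y; exists (p w); rewrite /= hp.
- by move=> g z; rewrite /= -fE; apply: f_fiber; rewrite sP p_act sP.
Qed.
End MaximalFactor.

(** * The Toeplitz subshift *)

Lemma measure_finite_bigcup d (T : measurableType d) (R : realType)
    (mu : {measure set T -> \bar R}%R) (I : finType) (F : I -> set T) :
  (forall i, measurable (F i)) -> trivIset setT F ->
  mu (\bigcup_i F i) = (\sum_(i : I) mu (F i))%E.
Proof.
move=> mF tF.
have -> : \bigcup_i F i = \bigcup_(i in [set` index_enum I]) F i.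
  apply/seteqP; split=> [t [i _ Fi]|t [i _ Fi]]; exists i => //.
  exact: mem_index_enum.
elim: (index_enum I) (index_enum_uniq I) => [_|i s IH /= /andP[is_ us]].
  by rewrite big_nil -[RHS](measure0 mu); congr (mu _);
    rewrite -subset0 => t [].
have -> : [set` i :: s] = i |` [set` s].
  apply/seteqP; split=> j /=; rewrite inE; first by move=> /orP[/eqP|];
    [left|right].
  by move=> [->|->]; rewrite ?eqxx ?orbT.
rewrite bigcup_setU1 big_cons -(IH us) measureU //.
  by apply: fin_bigcup_measurable => //; exact: finite_seq.
rewrite -subset0 => t [Fi [j /= js Fj]].
have /tF ij : (F i `&` F j) !=set0 by exists t.
by move: is_; rewrite ij // js.
Qed.

(** * Mass transport against invariant probabilities *)

Section NoInvariantMeasure.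
Variables (R : realType) (G : groupType) (S : {fset G}).
Let A : finType := ({ffun bool -> S} * bool)%type.
Variable X : subshift G A.
Hypothesis X_injective : forall w, subshift_set X w -> forall g h i j,
  (g * val ((w g).1 i) = h * val ((w h).1 j))%g -> g = h /\ i = j.

(* Every [g] sends unit mass to [g * (w g).1 i] for both [i], while injectivity
   lets it receive at most unit mass; invariance equates the expectations. *)
Lemma no_invariant_probability :
  ~ has_invariant_probability R (@subshift_act G A X).
Proof.
move=> [x0 [P Pinv]].
(* In [V i s] the identity sends its unit of index [i] to [s]; in [U (i, s)] the element [s^-1]
   sends its unit of index [i] to the identity. *)
pose V i s : set (borel x0) := [set w : set_type X | (val w 1%g).1 i = s].
pose U (q : bool * S) : set (borel x0) := subshift_act (val q.2) @^-1` V q.1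
  q.2.
have mV i s : measurable (V i s).
  apply: sub_sigma_algebra; rewrite openE => w Vw.
  apply/nbhs_subshift_window; exists [:: 1%g] => v vw.
  by rewrite /V /= (vw 1%g) // inE.
have UE q w : U q w -> (val w (val q.2)^-1%g).1 q.1 = q.2.
  by rewrite /U /V /= /gshift mulg1.
have mU q : measurable (U q).
  apply: sub_sigma_algebra; rewrite openE => w /UE Uw.
  apply/nbhs_subshift_window; exists [:: (val q.2)^-1%g] => v vw.
  by rewrite /U /V /= /gshift mulg1 (vw _ (mem_head _ _)).
have sumV i : (\sum_(s : S) P (V i s) = 1)%E.
  rewrite -measure_finite_bigcup //; last first.
    by move=> s t _ _ [w [<- <-]].
  rewrite -(probability_setT P); congr (P _); apply/seteqP; split=> // w _.
  by exists ((val w 1%g).1 i).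
have sumU : (\sum_(q : bool * S) P (U q) <= 1)%E.
  rewrite -measure_finite_bigcup //; first apply: probability_le1.
    by apply: fin_bigcup_measurable; first exact: finite_finset.
  move=> [i s] [j t] _ _ [w [/UE /= ws /UE /= wt]].
  have [|st ij] := X_injective (set_mem (valP w)) (g := (val s)^-1%g)
     (h := (val t)^-1%g) (i := i) (j := j).
    by rewrite ws wt !mulVg.
  by rewrite ij; congr pair; apply/val_inj/(can_inj invgK).
have sumE : (\sum_(q : bool * S) P (U q) = \sum_(i : bool) \sum_(s :
  S) P (V i s))%E.
  rewrite pair_bigA /=; apply: eq_bigr => q _; exact: Pinv.
move: sumU; rewrite sumE.
under eq_bigr do rewrite sumV.
by rewrite big_bool /= -EFinD lee_fin; lra.
Qed.
End NoInvariantMeasure.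

Theorem theorem2 (R : realType) (G : groupType)
    (G_countable : countable [set: G])
    (G_nonamenable : ~ amenable R G)
    (G_residually_finite : residually_finite G)
    (Z : metricType R) (c : G -> Z -> Z)
    (Z_system : dynamical_system c)
    (Z_cantor : cantor_set Z)
    (Z_minimal : minimal_system c)
    (Z_equicontinuous : unif_equicontinuous c)
    (Z_free_orbit : has_free_orbit c) :
  exists (S : finType) (X : subshift G S),
    [/\ (1 < #|S|)%N,
        toeplitz_subshift X,
        ~ has_invariant_probability R (@subshift_act G S X) &
        maximal_equicontinuous_factor (@subshift_act G S X) c].
Proof.
have [z0 z0_free] := Z_free_orbit.
have [S [S0 expS]] := nonamenable_expansion G_countable G_nonamenable.
have [s0 s0S] := fset0Pn _ S0.
have [E [E_equiv E0 E_decr E_mesh E_strict]] :=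
  equivalence_chain Z_system Z_cantor Z_minimal Z_equicontinuous z0.
pose Gam := return_group c z0 E.
have Gam_subgroup := return_group_subgroup Z_system z0 E_equiv.
have Gam_index := return_group_index Z_system Z_cantor z0 E_equiv.
have Gam_decr n : Gam n.+1 `<=` Gam n by move=> g; exact: E_decr.
(* An element of all return groups fixes [z0], since the mesh of [E n] tends to 0; freeness makes it
   trivial. *)
have Gam_sep g : g <> 1%g -> exists n, ~ Gam n g.
  move=> g1; apply: contrapT => /forallNP all_g; apply: g1; apply: z0_free.
  apply/eqP/negPn/negP; rewrite -mdist_gt0 => /E_mesh[n].
  by move=> /(_ _ _ (contrapT (all_g n))); rewrite ltxx.
have [l [l_per l_inj]] :=
  paradoxical_labeling Gam_subgroup Gam_decr Gam_sep [` s0S]%fset G_countable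
    expS.
have [|n|b [b_per b_rec]] := recognizing_bit G_countable Gam_subgroup Gam_index
  _ Gam_decr.
- by apply/seteqP; split=> // g _; exact: E0.
- by have [g [gn gSn]] := E_strict n; exists g.
pose A : finType := ({ffun bool -> S} * bool)%type.
pose x : full_shift G A := fun g => (l g, b g).
have x_per g : exists n, forall a, Gam n a -> x (a * g)%g = x g.
  have [m lm] := l_per g; have [n bn] := b_per g; exists (maxn m n) => a aG.
  by rewrite /x lm ?bn //; apply: chain_le Gam_decr _ _ _ _ aG;
    rewrite ?leq_maxl ?leq_maxr.
have [K KP] := choice b_rec.
exists A, (orbit_closure x); split.
- rewrite card_prod card_bool muln2.
  have : (0 < #|{ffun bool -> S}|)%N by apply/card_gt0P; exists (l 1%g).
  by case: #|{ffun bool -> S}|.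
- exists x => // g; have [n gn] := x_per g; exists (Gam n); split=> // a aG.
  by rewrite gn //; case: (Gam_subgroup n) => _ _; exact.
- apply: no_invariant_probability => w Xw g h i j.
  (* On two positions [w] agrees with a translate of [x], so injectivity passes to the orbit
     closure. *)
  have [a aw] : exists a, {in [:: g; h], gshift a x =1 w}.
    exact: (closure_orbitP x w).1 Xw [:: g; h].
  rewrite -(aw g) ?inE ?eqxx // -(aw h) ?inE ?eqxx ?orbT // /gshift /= => E'.
  have [|/mulgI] := l_inj (a^-1 * g)%g (a^-1 * h)%g i j; last by [].
  by rewrite -!mulgA E'.
- have x_rec n u v : {in K n, forall k, x (u * k)%g = x (v * k)%g} ->
      Gam n (u * v^-1)%g.
    by move=> uv; apply: KP => k kK; exact: (congr1 snd (uv k kK)).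
  exact: (orbit_closure_maximal_factor Z_system Z_minimal Z_equicontinuous
    E_equiv
    E_decr E_mesh x_per x_rec).
Qed.
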